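(* Let $C$ be the group with generators $u_1,\dots,u_{27}$ and relations (R1)–(R4) below, and let $\psi_C\colon C\to S_{18}$ be the homomorphism sending $u_j$ to the transposition $(\alpha\,\beta)$, where $\{\alpha,\beta\}$ is the pair of endpoints of edge $j$ of $T$. Then: (i) $\psi_C$ is surjective. The subgroup $\langle u_j : j\in T_0\rangle$, where $T_0=\{5,6,8,9,11,12,14,16,18,19,20,21,22,24,25,26,27\}$ is a spanning tree of $T$, is mapped isomorphically onto $S_{18}$ by $\psi_C$. Hence $C=S_{18}\ltimes K_C$ with $K_C=\ker\psi_C$. (ii) Let $H$ be the group generated by $x_1,\dots,x_{18},y_1,\dots,y_{18},z$ with relations $[x_i,x_j]=[y_i,y_j]=[x_i,y_j]=1$ for all $i\neq j$, $[x_i,y_i]=z$ for all $i$, and $z$ central. Let $\mathrm{ab}\colon H\to\mathbb{Z}^2=\langle x\rangle\times\langle y\rangle$ be given by $x_i\mapsto x$, $y_i\mapsto y$, $z\mapsto 1$. Then $K_C\cong\ker(\mathrm{ab})$. Moreover $C\cong S_{18}\ltimes\ker(\mathrm{ab})$, where $\sigma\in S_{18}$ acts by $x_i\mapsto x_{\sigma(i)}$, $y_i\mapsto y_{\sigma(i)}$, $z\mapsto z$, and under this isomorphism $\psi_C$ corresponds to the projection onto $S_{18}$. (iii) In particular, $K_C$ is a central extension of $\mathbb{Z}^{34}$ by $\mathbb{Z}=\langle z\rangle$, and the center of $C$ is the infinite cyclic group $\langle z\rangle$.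
   Context: Let $T$ be the graph with vertex set $\{1,\dots,18\}$ and 27 edges labelled $1,\dots,27$. Edge $j$ joins the two vertices listed after it: 1:$\{2,7\}$, 2:$\{1,13\}$, 3:$\{4,9\}$, 4:$\{1,3\}$, 5:$\{1,5\}$, 6:$\{2,3\}$, 7:$\{2,6\}$, 8:$\{3,10\}$, 9:$\{4,6\}$, 10:$\{4,5\}$, 11:$\{5,8\}$, 12:$\{6,14\}$, 13:$\{7,15\}$, 14:$\{7,11\}$, 15:$\{8,12\}$, 16:$\{8,16\}$, 17:$\{9,11\}$, 18:$\{9,17\}$, 19:$\{10,12\}$, 20:$\{10,18\}$, 21:$\{11,12\}$, 22:$\{13,15\}$, 23:$\{13,17\}$, 24:$\{14,18\}$, 25:$\{14,16\}$, 26:$\{15,16\}$, 27:$\{17,18\}$. (Geometrically, the vertices of $T$ are the 18 planes and the edges are the 27 intersection lines of a degeneration of $\mathbb{T}\times\mathbb{T}$, for $\mathbb{T}$ a complex torus, into a union of planes. This triangulates a torus with 9 vertices $V_1,\dots,V_9$, each lying on 6 lines.) Nine hexagons in $T$ are given by ordered 6-tuples of edges $(a_r,b_r,c_r,d_r,e_r,f_r)$, $r=1,\dots,9$: $V_1$: $(2,4,6,1,13,22)$; $V_2$: $(1,7,9,3,17,14)$; $V_3$: $(3,10,5,2,23,18)$; $V_4$: $(11,15,19,8,4,5)$; $V_5$: $(8,20,24,12,7,6)$; $V_6$: $(12,25,16,11,10,9)$; $V_7$: $(26,13,14,21,15,16)$; $V_8$: $(21,17,18,27,20,19)$; $V_9$: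 $(27,23,22,26,25,24)$. In each tuple, cyclically consecutive edges share an endpoint, so the six edges form a 6-cycle in $T$. The group $C$ is generated by $u_1,\dots,u_{27}$ with the relations: (R1) $u_j^2=1$ for all $j$; (R2) $u_iu_j=u_ju_i$ whenever edges $i$ and $j$ have no common endpoint; (R3) $u_iu_ju_i=u_ju_iu_j$ whenever $i\neq j$ and edges $i,j$ share an endpoint; (R4) for each $r=1,\dots,9$: $u_{a_r}u_{b_r}u_{c_r}u_{d_r}u_{e_r}=u_{b_r}u_{c_r}u_{d_r}u_{e_r}u_{f_r}$. *)

(* Defs.v *)
(* Abstract (possibly infinite) groups are given by an
   explicit record with the group axioms; finitely presented groups are
   characterised by their universal property. *)
From mathcomp Require Import all_boot all_order all_algebra all_fingroup.
Set Implicit Arguments. Unset Strict Implicit. Unset Printing Implicit Defensive.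

Record agroup := AGroup {
  gcar :> Type;
  gmul : gcar -> gcar -> gcar;
  gone : gcar;
  ginv : gcar -> gcar;
  gmulA : forall a b c, gmul a (gmul b c) = gmul (gmul a b) c;
  gmul1 : forall a, gmul gone a = a;
  gmulV : forall a, gmul (ginv a) a = gone }.

Arguments gmul {_}. Arguments gone {_}. Arguments ginv {_}.
Notation "a ** b" := (gmul a b) (at level 40, left associativity).

Definition ghom (G G' : agroup) (f : G -> G') : Prop :=
  forall a b : G, f (a ** b) = f a ** f b.

Definition gker (G G' : agroup) (f : G -> G') : G -> Prop := fun a => f a = gone.

Definition gcomm (G : agroup) (a b : G) : G := ginv a ** ginv b ** a ** b.

Fixpoint gpown (G : agroup) (a : G) (n : nat) : G :=
  match n with O => gone | S n => gpown a n ** a end.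
Definition gpow (G : agroup) (a : G) (n : int) : G :=
  match n with Posz m => gpown a m | Negz m => ginv (gpown a m.+1) end.

Inductive gen_sub (G : agroup) (S : G -> Prop) : G -> Prop :=
| gen_one : gen_sub S gone
| gen_in  : forall a, S a -> gen_sub S a
| gen_mul : forall a b, gen_sub S a -> gen_sub S b -> gen_sub S (a ** b)
| gen_inv : forall a, gen_sub S a -> gen_sub S (ginv a).

Definition central (G : agroup) (a : G) : Prop := forall b : G, a ** b = b ** a.

Definition iso_on (G G' : agroup) (f : G -> G') (A : G -> Prop) (B : G' -> Prop) : Prop :=
  [/\ (forall a b, A a -> A b -> f (a ** b) = f a ** f b),
      (forall a, A a -> B (f a)),
      (forall a b, A a -> A b -> f a = f b -> a = b) &
      (forall b, B b -> exists a, A a /\ f a = b)].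

Definition PermGroup : agroup :=
  @AGroup {perm 'I_18} (fun s t => (s * t)%g) 1%g (fun s => s^-1)%g
    (@mulgA _) (@mul1g _) (@mulVg _).

Definition ZmodGroup (V : zmodType) : agroup :=
  @AGroup V (fun a b => (a + b)%R) 0%R (fun a => (- a)%R)
    (@GRing.addrA V) (@GRing.add0r V) (@GRing.addNr V).

Definition Z2 : agroup := ZmodGroup 'rV[int]_2.
Definition Z34 : agroup := ZmodGroup 'rV[int]_34.
Definition xZ : 'rV[int]_2 := delta_mx ord0 ord0.
Definition yZ : 'rV[int]_2 := delta_mx ord0 (inord 1).

(* edge j (1-based) joins the two (1-based) vertices listed *)
Definition edges : seq (nat * nat) :=
  [:: (2,7); (1,13); (4,9); (1,3); (1,5); (2,3); (2,6); (3,10); (4,6);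
      (4,5); (5,8); (6,14); (7,15); (7,11); (8,12); (8,16); (9,11); (9,17);
      (10,12); (10,18); (11,12); (13,15); (13,17); (14,18); (14,16);
      (15,16); (17,18)].

(* vertex v (1-based) as an element of 'I_18 (i.e. vertex v is v-1) *)
Definition vtx (v : nat) : 'I_18 := inord v.-1.
(* edge k (1-based) as an element of 'I_27 *)
Definition edg (k : nat) : 'I_27 := inord k.-1.

Definition ep1 (j : 'I_27) : 'I_18 := vtx (nth (0,0) edges j).1.
Definition ep2 (j : 'I_27) : 'I_18 := vtx (nth (0,0) edges j).2.

Definition share (i j : 'I_27) : bool :=
  [|| ep1 i == ep1 j, ep1 i == ep2 j, ep2 i == ep1 j | ep2 i == ep2 j].

(* the nine hexagons (a,b,c,d,e,f), edge labels 1-based *)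
Definition hexagons : seq (seq nat) :=
  [:: [:: 2;4;6;1;13;22]; [:: 1;7;9;3;17;14]; [:: 3;10;5;2;23;18];
      [:: 11;15;19;8;4;5]; [:: 8;20;24;12;7;6]; [:: 12;25;16;11;10;9];
      [:: 26;13;14;21;15;16]; [:: 21;17;18;27;20;19]; [:: 27;23;22;26;25;24]].

Definition T0 : seq 'I_27 :=
  map edg [:: 5;6;8;9;11;12;14;16;18;19;20;21;22;24;25;26;27].

Definition hex_rel (G : agroup) (g : 'I_27 -> G) (h : seq nat) : Prop :=
  let U k := g (edg (nth 0 h k)) in
  U 0 ** U 1 ** U 2 ** U 3 ** U 4 = U 1 ** U 2 ** U 3 ** U 4 ** U 5.

Definition CRel (G : agroup) (g : 'I_27 -> G) : Prop :=
  [/\ (forall j, g j ** g j = gone),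
      (forall i j, ~~ share i j -> g i ** g j = g j ** g i),
      (forall i j, i != j -> share i j ->
                   g i ** g j ** g i = g j ** g i ** g j) &
      (forall h, h \in hexagons -> hex_rel g h)].

Definition presentsC (C : agroup) (u : 'I_27 -> C) : Prop :=
  CRel u /\
  forall (G : agroup) (g : 'I_27 -> G), CRel g ->
    exists! f : C -> G, ghom f /\ forall j, f (u j) = g j.

Definition HRel (G : agroup) (x y : 'I_18 -> G) (z : G) : Prop :=
  [/\ (forall i j, i != j ->
         [/\ gcomm (x i) (x j) = gone, gcomm (y i) (y j) = gone &
             gcomm (x i) (y j) = gone]),
      (forall i, gcomm (x i) (y i) = z) &
      central z].

Definition presentsH (H : agroup) (x y : 'I_18 -> H) (z : H) : Prop :=
  HRel x y z /\
  forall (G : agroup) (x' y' : 'I_18 -> G) (z' : G), HRel x' y' z' ->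
    exists! f : H -> G,
      [/\ ghom f, (forall i, f (x i) = x' i), (forall i, f (y i) = y' i) & f z = z'].

(* Main.v *)
Require Import Defs.
From mathcomp Require Import all_boot all_order all_algebra all_fingroup.
From mathcomp Require Import ring zify.
Set Implicit Arguments. Unset Strict Implicit. Unset Printing Implicit Defensive.
Import GRing.Theory.

(* The dual of the torus triangulation lifts to a planar hexagonal lattice, so a
   reflection of C should be determined by a pair of vertices p, q of T and a
   displacement (m, n) in Z^2.  In the model S_18 |x Heis this is the reflection
   [srefl p q m n], and reflections slide along paths of T, which gives (R1)-(R4).

   For injectivity, the edges of a Hamiltonian path of T satisfy the Coxeter
   relations, which gives iota : S_18 -> C.  Conjugating u_13 and u_8 by iota yields
   families A_pq and B_pq (displacements (1,0) and (0,1)); this is well defined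
   because hexagons imply that u_k commutes with the transposition of the two path
   neighbours of its inner endpoint.  The translations X_pq = tau_pq A_pq commute,
   X_pq X_qr = X_pr, and likewise for Y_pq = tau_pq B_pq; X_pq and Y_rs commute for
   distinct p, q, r, s.  Seven hexagons express the other edges, except u_15, through
   tau, A and B; the last two give two expressions of u_15, whose equality forces
   [X_pq, Y_ps] to be independent of p, hence central.  So every element of C is
   iota(s) X^a Y^b Z^c with a, b of sum zero, and these are separated by the model. *)

(** The tree [T0] branches, while the Coxeter theorem proved here concerns a chain of adjacent
    transpositions. Hence the Hamiltonian path: it carries the copy of $S_{18}$ in C, and [T0] is
    treated only in the model, where conjugation by one Heisenberg element straightens its
    reflections. With displacements normalised to vanish on the path, edges 13 and 8 carry the two
    basis displacements, and edge 15 is the only one displaced in both directions. It is therefore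
    the only generator in which the two families A and B meet. The normal form uses the translations
    based at a single vertex. A permutation moves that vertex, and the resulting error is a power
    whose exponent is the coordinate sum. So multiplicativity is available for sum-zero vectors
    only, which is why [balanced] accompanies every statement about the model. Injectivity is then
    formal: the normal form composed with the map to the model fixes the generators of C, so it is
    the identity by uniqueness in the universal property. *)

Arguments gmul {_} _ _ : simpl never.
Arguments gone {_} : simpl never.
Arguments ginv {_} _ : simpl never.

(** * Abstract groups *)

Section AbstractGroup.
Variable G : agroup.
Implicit Types a b c : G.

Lemma gmulrV a : a ** ginv a = gone.
Proof.
rewrite -[LHS]gmul1 -[X in X ** _](gmulV (ginv a)) gmulA -(gmulA _ _ a).
by rewrite gmulV -gmulA gmul1 gmulV.
Qed.

Lemma gmulr1 a : a ** gone = a.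
Proof. by rewrite -(gmulV a) gmulA gmulrV gmul1. Qed.

Lemma gmulK a b : a ** b ** ginv b = a.
Proof. by rewrite -gmulA gmulrV gmulr1. Qed.

Lemma gmulVK a b : a ** ginv b ** b = a.
Proof. by rewrite -gmulA gmulV gmulr1. Qed.

Lemma gmulKl a b : ginv a ** (a ** b) = b.
Proof. by rewrite gmulA gmulV gmul1. Qed.

Lemma gmulI a b c : a ** b = a ** c -> b = c.
Proof. by move=> e; rewrite -(gmulKl a b) e gmulKl. Qed.

Lemma gmulIr a b c : b ** a = c ** a -> b = c.
Proof. by move=> e; rewrite -(gmulK b a) e gmulK. Qed.

Lemma ginv_eq a b : a ** b = gone -> ginv a = b.
Proof. by move=> e; apply: (@gmulI a); rewrite e gmulrV. Qed.

Lemma ginvK a : ginv (ginv a) = a.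
Proof. by apply: ginv_eq; rewrite gmulV. Qed.

Lemma ginvM a b : ginv (a ** b) = ginv b ** ginv a.
Proof. by apply: ginv_eq; rewrite gmulA gmulK gmulrV. Qed.

Lemma ginv1 : ginv gone = gone :> G.
Proof. by apply: ginv_eq; rewrite gmul1. Qed.

Definition gcommute a b := a ** b = b ** a.

Lemma gcommuteC a b : gcommute a b -> gcommute b a.
Proof. by []. Qed.

Lemma gcommute1 a : gcommute a gone.
Proof. by rewrite /gcommute gmul1 gmulr1. Qed.

Lemma gcommuteM a b c : gcommute a b -> gcommute a c -> gcommute a (b ** c).
Proof. by rewrite /gcommute => e1 e2; rewrite gmulA e1 -gmulA e2 gmulA. Qed.

Lemma gcommuteV a b : gcommute a b -> gcommute a (ginv b).
Proof.
by rewrite /gcommute => e; apply: (@gmulI b); rewrite !gmulA gmulrV gmul1 -e gmulK.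
Qed.

Lemma gcommuteMl a b c : gcommute b a -> gcommute c a -> gcommute (b ** c) a.
Proof. by move=> *; apply/gcommuteC/gcommuteM; apply/gcommuteC. Qed.

Lemma gcommuteVl a b : gcommute b a -> gcommute (ginv b) a.
Proof. by move=> *; apply/gcommuteC/gcommuteV/gcommuteC. Qed.

Definition gconj a b := ginv b ** a ** b.

Lemma gconj_eq a b c : a ** b = b ** c -> gconj a b = c.
Proof. by move=> e; rewrite /gconj -gmulA e gmulKl. Qed.

Lemma gconjE a b : a ** b = b ** gconj a b.
Proof. by rewrite /gconj !gmulA gmulrV gmul1. Qed.

Lemma gconjM a b c : gconj (a ** b) c = gconj a c ** gconj b c.
Proof. by rewrite /gconj !gmulA gmulK. Qed.

Lemma gconjMr a b c : gconj a (b ** c) = gconj (gconj a b) c.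
Proof. by rewrite /gconj ginvM !gmulA. Qed.

Lemma gconj1r a : gconj a gone = a.
Proof. by rewrite /gconj ginv1 gmul1 gmulr1. Qed.

Lemma gconj1 a : gconj gone a = gone.
Proof. by rewrite /gconj gmulr1 gmulV. Qed.

Lemma gconjV a b : gconj (ginv a) b = ginv (gconj a b).
Proof. by rewrite /gconj !ginvM ginvK gmulA. Qed.

Lemma gconj_gconj a b c : gconj (gconj a b) c = gconj (gconj a c) (gconj b c).
Proof. by rewrite -gconjMr gconjE gconjMr /gconj !gmulA ?gmulK. Qed.

Lemma gconj_inj a b c : gconj a c = gconj b c -> a = b.
Proof. by rewrite /gconj => /gmulIr /gmulI. Qed.

Lemma gconj_id a b : gcommute a b -> gconj a b = a.
Proof. by move=> e; apply: gconj_eq. Qed.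

Lemma gconj_idP a b : gconj a b = a -> gcommute a b.
Proof. by move=> e; rewrite /gcommute gconjE e. Qed.

Lemma gcommute_conj a b c : gcommute a b -> gcommute (gconj a c) (gconj b c).
Proof. by rewrite /gcommute -!gconjM => ->. Qed.

Lemma gcommE a b : gcomm a b = ginv a ** gconj a b.
Proof. by rewrite /gcomm /gconj !gmulA. Qed.

Lemma gcomm_eq1 a b : gcomm a b = gone <-> gcommute a b.
Proof.
rewrite /gcomm; split=> [e|e].
  by apply: (@gmulI (ginv b)); apply: (@gmulI (ginv a)); rewrite !gmulA e gmulVK gmulV.
by rewrite -gmulA e gmulA gmulVK gmulV.
Qed.

Lemma gcomm_eq a b c : a ** b = b ** a ** c -> gcomm a b = c.
Proof. by move=> e; rewrite /gcomm -gmulA e !gmulA gmulVK gmulV gmul1. Qed.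

Lemma gcommP a b : a ** b = b ** a ** gcomm a b.
Proof. by rewrite /gcomm !gmulA gmulK gmulrV gmul1. Qed.

Lemma gcomm_mull a b c : gcommute a c -> gcomm (a ** b) c = gcomm b c.
Proof.
by move=> ac; apply: gcomm_eq; rewrite -gmulA (gcommP b c) !gmulA ac.
Qed.

Lemma gcomm_mulr a b c : gcommute a b -> gcomm a (b ** c) = gcomm a c.
Proof.
move=> ab; apply: gcomm_eq; rewrite gmulA ab -!gmulA; congr (_ ** _).
by rewrite gmulA -gcommP.
Qed.

Lemma gcommVV a b : gcommute a (gcomm a b) -> gcommute b (gcomm a b) ->
  gcomm (ginv a) (ginv b) = gcomm a b.
Proof.
move=> az bz; rewrite {1}/gcomm !ginvK (gcommP a b).
have -> : b ** a ** gcomm a b = gcomm a b ** (b ** a) by apply: gcommuteMl.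
by rewrite gmulA gmulK gmulK.
Qed.

Lemma gcommute_gcomm a b c : gcommute c a -> gcommute c b -> gcommute c (gcomm a b).
Proof.
by move=> ca cb; do 3!apply: gcommuteM => //; apply: gcommuteV.
Qed.

Lemma gcomm_conj a b c : gconj (gcomm a b) c = gcomm (gconj a c) (gconj b c).
Proof. by rewrite /gcomm !gconjM !gconjV. Qed.

End AbstractGroup.

Section Homomorphism.
Variables (G K : agroup) (f : G -> K).
Hypothesis fM : ghom f.

Lemma ghom1 : f gone = gone.
Proof. by apply: (@gmulI _ (f gone)); rewrite -fM gmul1 gmulr1. Qed.

Lemma ghomV a : f (ginv a) = ginv (f a).
Proof. by apply/esym/ginv_eq; rewrite -fM gmulrV ghom1. Qed.

Lemma ghom_gconj a b : f (gconj a b) = gconj (f a) (f b).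
Proof. by rewrite /gconj !fM ghomV. Qed.

Lemma ghom_gcomm a b : f (gcomm a b) = gcomm (f a) (f b).
Proof. by rewrite /gcomm !fM !ghomV. Qed.

End Homomorphism.

(** * Integer powers *)

Section Powers.
Variable G : agroup.
Implicit Types a b : G.
Local Open Scope ring_scope.

Lemma gcommute_gpown a b n : gcommute a b -> gcommute a (gpown b n).
Proof.
by move=> e; elim: n => [|n IH] /=; [apply: gcommute1 | apply: gcommuteM].
Qed.

Lemma gcommute_gpow a b n : gcommute a b -> gcommute a (gpow b n).
Proof.
move=> e; case: n => n; first exact: gcommute_gpown.
exact/gcommuteV/gcommute_gpown.
Qed.

Lemma gpow_succ a (n : int) : gpow a (n + 1) = gpow a n ** a.
Proof.
case: n => [n|[|n]]; first by rewrite -PoszD addn1.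
  by rewrite /= gmul1 gmulV.
have -> : Negz n.+1 + 1 = Negz n by lia.
rewrite /gpow (_ : gpown a n.+2 = a ** gpown a n.+1); last first.
  by rewrite [LHS]/=; apply/gcommuteC/(@gcommute_gpown a a n.+1).
by rewrite ginvM gmulVK.
Qed.

Lemma gpow_pred a (n : int) : gpow a (n - 1) = gpow a n ** ginv a.
Proof. by apply: (@gmulIr _ a); rewrite -gpow_succ subrK gmulVK. Qed.

Lemma gpowD a (m n : int) : gpow a (m + n) = gpow a m ** gpow a n.
Proof.
elim: n => [|n IH|n IH].
- by rewrite addr0 gmulr1.
- by rewrite -addn1 PoszD addrA !gpow_succ IH gmulA.
- by rewrite -addn1 PoszD opprD addrA !gpow_pred IH gmulA.
Qed.

Lemma gpowN a (n : int) : gpow a (- n) = ginv (gpow a n).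
Proof. by apply/esym/ginv_eq; rewrite -gpowD subrr. Qed.

Lemma gpow1 a : gpow a 1 = a.
Proof. by rewrite /= gmul1. Qed.

Lemma ghom_scale (V : zmodType) (f : ZmodGroup V -> G) : ghom f ->
  forall (v : V) n, f (v *~ n) = gpow (f v) n.
Proof.
move=> fM v; have f1 : f (0 : V) = gone by exact: (ghom1 fM).
have fN w : f (- w : V) = ginv (f w) by exact: (ghomV fM).
have fD w w' : f (w + w' : V) = f w ** f w' by exact: (fM w w').
elim=> [|n IH|n IH].
- by rewrite mulr0z.
- by rewrite -addn1 PoszD mulrzDr mulr1z fD IH gpow_succ.
- by rewrite -addn1 PoszD opprD mulrzDr fD IH mulrNz mulr1z fN gpow_pred.
Qed.

(** The working tool for products of powers: once both sides are additive in the exponent vector,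
    only basis vectors have to be checked. *)
Lemma ghom_rV_ext n (f g : ZmodGroup 'rV[int]_n -> G) : ghom f -> ghom g ->
  (forall i, f (delta_mx 0 i) = g (delta_mx 0 i)) -> forall v, f v = g v.
Proof.
move=> fM gM fg v; rewrite (row_sum_delta v).
elim/big_ind: _ => [|w w' e e'|i _]; first by rewrite (ghom1 fM) (ghom1 gM).
  by rewrite (fM w w') (gM w w') e e'.
have -> : v 0 i *: delta_mx 0 i = delta_mx 0 i *~ v 0 i :> 'rV[int]_n.
  by rewrite -scaler_int intz.
by rewrite !ghom_scale ?fg.
Qed.

Definition gprodz n (X : 'I_n -> G) (a : 'rV[int]_n) : G :=
  \big[gmul/gone]_(i < n) gpow (X i) (a 0 i).

Lemma gcommute_big (I : Type) (r : seq I) (F : I -> G) b :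
  (forall i, gcommute b (F i)) -> gcommute b (\big[gmul/gone]_(i <- r) F i).
Proof.
move=> bF; elim/big_ind: _ => [|c d|i _]; [exact: gcommute1 | exact: gcommuteM |].
exact: bF.
Qed.

Lemma gcommute_gprodz n (X : 'I_n -> G) v b :
  (forall i, gcommute b (X i)) -> gcommute b (gprodz X v).
Proof. by move=> bX; apply: gcommute_big => i; apply: gcommute_gpow. Qed.

Lemma gprodz_hom n (X : 'I_n -> G) : (forall i j, gcommute (X i) (X j)) ->
  @ghom (ZmodGroup 'rV[int]_n) G (gprodz X).
Proof.
move=> XX a b; rewrite /gprodz; elim: (index_enum _) => [|i r IH].
  by rewrite !big_nil gmul1.
rewrite !big_cons IH mxE gpowD -!gmulA; congr (_ ** _).
rewrite !gmulA; congr (_ ** _); apply: gcommute_big => j.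
by apply/gcommute_gpow/gcommuteC/gcommute_gpow.
Qed.

Lemma gprodz_delta n (X : 'I_n -> G) i : gprodz X (delta_mx 0 i) = X i.
Proof.
rewrite /gprodz; have: uniq (index_enum 'I_n) by exact: index_enum_uniq.
have: i \in index_enum 'I_n by exact: mem_index_enum.
have big1r r : i \notin r ->
    \big[gmul/gone]_(j <- r) gpow (X j) (delta_mx 0 i 0 j : int) = gone.
  elim: r => [|j r IH]; rewrite ?big_nil // inE negb_or => /andP[ij /IH e].
  by rewrite big_cons e mxE eqxx eq_sym (negPf ij) gmul1.
elim: (index_enum _) => // j r IH; rewrite inE big_cons => + /= /andP[jr ur].
have [ij _|ij /= ir] := eqVneq i j.
  by rewrite -ij in jr *; rewrite big1r // mxE !eqxx gmulr1; apply: gpow1.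
by rewrite IH // mxE eqxx eq_sym (negPf ij) gmul1.
Qed.

End Powers.

Lemma ghom_gpow (G K : agroup) (f : G -> K) a n : ghom f -> f (gpow a n) = gpow (f a) n.
Proof.
move=> fM; elim: n => [|n IH|n IH].
- exact: ghom1.
- by rewrite -addn1 PoszD !gpow_succ fM IH.
- by rewrite -addn1 PoszD opprD !gpow_pred fM IH ghomV.
Qed.

(** * Heisenberg commutation relations and normal forms in an arbitrary group *)

Section HeisenbergFamilies.
Local Open Scope ring_scope.
Variables (G : agroup) (n : nat) (X Y : 'I_n -> G) (Z : G) (B : 'M[int]_n).
Hypothesis XX : forall i j, gcommute (X i) (X j).
Hypothesis YY : forall i j, gcommute (Y i) (Y j).
Hypothesis XZ : forall i, gcommute Z (X i).
Hypothesis YZ : forall i, gcommute Z (Y i).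
Hypothesis XY : forall i j, X i ** Y j = Y j ** X i ** gpow Z (B i j).

Lemma gprodz_gpow (W : 'I_n -> G) a m : (forall i, gcommute Z (W i)) ->
  gcommute (gprodz W a) (gpow Z m).
Proof. by move=> ZW; apply/gcommute_gpow/gcommuteC/gcommute_gprodz. Qed.

Lemma gprodz_mul_hom (W : 'I_n -> G) (l : 'rV[int]_n -> int) :
  (forall i j, gcommute (W i) (W j)) -> (forall i, gcommute Z (W i)) ->
  {morph l : v w / v + w} ->
  @ghom (ZmodGroup 'rV[int]_n) G (fun v => gprodz W v ** gpow Z (l v)).
Proof.
move=> WW ZW lD v w; rewrite (gprodz_hom WW v w) lD gpowD.
rewrite -!gmulA; congr (_ ** _); rewrite !gmulA; congr (_ ** _).
exact: gprodz_gpow.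
Qed.

Definition heis_form (a b : 'rV[int]_n) : int := (a *m B *m b^T) 0 0.

Lemma heis_formDl b : {morph heis_form^~ b : a a' / a + a'}.
Proof. by move=> a a'; rewrite /heis_form !mulmxDl !mxE. Qed.

Lemma heis_formDr a : {morph heis_form a : b b' / b + b'}.
Proof. by move=> b b'; rewrite /heis_form linearD mulmxDr !mxE. Qed.

Lemma heis_form_delta i j : heis_form (delta_mx 0 i) (delta_mx 0 j) = B i j.
Proof. by rewrite /heis_form -rowE trmx_delta -colE !mxE. Qed.

Let heis_formNl b a : heis_form (- a) b = - heis_form a b.
Proof. by rewrite /heis_form !mulNmx !mxE. Qed.

(** [Z] being central for both families, commutators are bimultiplicative: the exponent extends from
    [B] additively in [b] for a fixed [X i], then additively in [a]. *)
Lemma gprodz_comm a b :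
  gprodz X a ** gprodz Y b = gprodz Y b ** gprodz X a ** gpow Z (heis_form a b).
Proof.
have step i b' : gconj (gprodz Y b') (X i)
    = gprodz Y b' ** gpow Z (heis_form (- delta_mx 0 i) b').
  move: b'; apply: ghom_rV_ext.
  - by move=> v w; rewrite (gprodz_hom YY) gconjM.
  - exact/gprodz_mul_hom/heis_formDr.
  move=> j; rewrite gprodz_delta heis_formNl heis_form_delta; apply: gconj_eq.
  by rewrite gmulA XY -gmulA -gpowD subrr gmulr1.
suff e : gconj (gprodz X a) (gprodz Y b) = gprodz X a ** gpow Z (heis_form a b).
  by rewrite gconjE e gmulA.
move: a; apply: ghom_rV_ext.
- by move=> v w; rewrite (gprodz_hom XX) gconjM.
- exact/gprodz_mul_hom/heis_formDl.
move=> i; rewrite gprodz_delta; apply: gconj_eq.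
have := step i b; rewrite /gconj heis_formNl => e.
by apply: (@gmulI _ (ginv (X i))); rewrite gmulKl !gmulA e gpowN gmulVK.
Qed.

Definition heis_nf (a b : 'rV[int]_n) (c : int) : G :=
  gprodz X a ** gprodz Y b ** gpow Z c.

(** The minus sign is the cost of moving the [X] part with exponent [a'] left past the [Y] part with
    exponent [b]; [smul] has the same cocycle. *)
Lemma heis_nfM a b c a' b' c' :
  heis_nf a b c ** heis_nf a' b' c'
  = heis_nf (a + a') (b + b') (c + c' - heis_form a' b).
Proof.
have xD := gprodz_hom XX a a'; have yD := gprodz_hom YY b b'.
rewrite /heis_nf [gprodz X (a + a')]xD [gprodz Y (b + b')]yD.
rewrite -!gmulA; congr (_ ** _).
have yx : gprodz Y b ** gprodz X a'
    = gprodz X a' ** gprodz Y b ** gpow Z (- heis_form a' b).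
  by rewrite gprodz_comm -gmulA -gpowD subrr gmulr1.
rewrite (gmulA (gpow Z c)) -(gprodz_gpow a' c XZ) -!gmulA.
rewrite (gmulA (gpow Z c)) -(gprodz_gpow b' c YZ) -!gmulA -!gpowD.
rewrite (gmulA (gprodz Y b)) yx -!gmulA (gmulA (gpow Z _)).
rewrite -(gprodz_gpow b' _ YZ) -!gmulA -!gpowD.
by rewrite [- _ + _]addrC.
Qed.

End HeisenbergFamilies.

(** * The Coxeter presentation of the symmetric group *)

Definition coxeter (G : agroup) (N : nat) (t : nat -> G) : Prop :=
  [/\ forall i, i < N -> t i ** t i = gone,
      forall i j, i.+1 < j -> j < N -> gcommute (t i) (t j) &
      forall i, i.+1 < N -> t i ** t i.+1 ** t i = t i.+1 ** t i ** t i.+1].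

(* [descent t m d] is the word [t (m+d-1) ... t (m+1) t m]. *)
Fixpoint descent (G : agroup) (t : nat -> G) (m d : nat) : G :=
  if d is d'.+1 then t (m + d') ** descent t m d' else gone.

Lemma descentSr (G : agroup) (t : nat -> G) m d :
  descent t m d.+1 = descent t m.+1 d ** t m.
Proof.
elim: d => [|d IH]; first by rewrite /= addn0 gmul1 gmulr1.
by rewrite [LHS]/= -/(descent t m d.+1) IH gmulA addnS.
Qed.

Section Descent.
Variables (G : agroup) (N : nat) (t : nat -> G).
Hypothesis cox : coxeter N t.

Lemma descent_low m d i : i.+1 < m -> m + d <= N ->
  gcommute (t i) (descent t m d).
Proof.
move=> im; elim: d => [|d IH] md; first exact: gcommute1.
by case: cox => _ tt _; apply: gcommuteM; [apply: tt; lia | apply: IH; lia].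
Qed.

Lemma descent_high m d i : m + d < i -> i < N -> gcommute (t i) (descent t m d).
Proof.
move=> im iN; elim: d im => [|d IH] md; first exact: gcommute1.
case: cox => _ tt _; apply: gcommuteM; last by apply: IH; lia.
by apply/gcommuteC/tt; lia.
Qed.

(** [t i] passes the low letters until it meets [t i ** t i.-1]; the braid relation turns it into
    [t i.-1], which commutes with all higher letters. *)
Lemma descent_mid m d i : m < i -> i < m + d -> m + d <= N ->
  descent t m d ** t i = t i.-1 ** descent t m d.
Proof.
case: cox => _ tt br mi; elim: d => [|d IH] imd mdN; first lia.
have [im|im] := ltnP i (m + d).
  rewrite [descent _ _ _]/= -gmulA IH //; last lia.
  rewrite !gmulA; congr (_ ** _); apply/gcommuteC/tt; lia.
have {im}ei : i = m + d by lia.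
case: d imd mdN ei {IH} => [|d] imd mdN ei; first lia.
rewrite /= addnS in ei *; rewrite -!gmulA -(@descent_high m d i); [|lia|lia].
by rewrite ei !gmulA /=; congr (_ ** _); rewrite -br //; lia.
Qed.

End Descent.

Definition adj (i : nat) : PermGroup := tperm (inord i : 'I_18) (inord i.+1).

Lemma permgroupM (s t : PermGroup) (i : 'I_18) : (s ** t : PermGroup) i = t (s i).
Proof. exact: permM. Qed.

Lemma permgroup_conj (s t : PermGroup) : gconj s t = (s ^ t)%g.
Proof. by rewrite conjgE mulgA. Qed.

Lemma tperm_braid (T : finType) (p q r : T) : p != q -> q != r -> p != r ->
  (tperm p q * tperm q r * tperm p q = tperm p r)%g.
Proof.
by move=> pq qr pr; rewrite -mulgA -{1}[tperm p q]tpermV -conjgE tpermJ tpermR tpermD.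
Qed.

Lemma tpermJ_id (T : finType) (p q r s : T) : p != r -> p != s -> q != r -> q != s ->
  (tperm p q ^ tperm r s = tperm p q)%g.
Proof. by move=> *; rewrite tpermJ !tpermD // eq_sym. Qed.

Lemma inord_eq (i j : nat) : i < 18 -> j < 18 -> (inord i == inord j :> 'I_18) = (i == j).
Proof. by move=> hi hj; rewrite -val_eqE /= !inordK. Qed.

Lemma adj_coxeter : coxeter 17 adj.
Proof.
split=> [i _|i j ij j17|i i17].
- by rewrite /gmul /= tperm2.
- apply: gconj_idP; rewrite permgroup_conj; apply: tpermJ_id; rewrite inord_eq //; lia.
- rewrite /gmul /= /adj tperm_braid ?inord_eq //; try lia.
  rewrite ![tperm (inord i) _]tpermC [tperm (inord i.+1) _]tpermC tperm_braid ?inord_eq //; lia.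
Qed.

Lemma adj_fix i j : i < 17 -> j < 18 -> j != i -> j != i.+1 -> adj i (inord j) = inord j.
Proof. by move=> *; rewrite tpermD ?inord_eq // 1?eq_sym //; lia. Qed.

Lemma descent_adj_fix m d j : m + d < j -> j < 18 ->
  descent adj m d (inord j) = inord j.
Proof.
elim: d => [|d IH] jm j18; first by rewrite /= perm1.
by rewrite permgroupM adj_fix; try lia; apply: IH; lia.
Qed.

Lemma descent_adj_last m d : m + d < 18 -> descent adj m d (inord (m + d)) = inord m.
Proof.
elim: d => [|d IH] md; first by rewrite addn0 /= perm1.
by rewrite permgroupM addnS tpermR IH //; lia.
Qed.

Definition fixes_from (k : nat) (s : PermGroup) :=
  forall j, k <= j -> j < 18 -> s (inord j) = inord j.

Lemma fixes_from_bound k (s : PermGroup) :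
  k < 18 -> fixes_from k.+1 s -> (s (inord k) : nat) <= k.
Proof.
move=> k18 sk; rewrite leqNgt; apply/negP => ks.
have := sk _ ks (ltn_ord _); rewrite inord_val => /perm_inj e.
by move: ks; rewrite e inordK ?ltnn.
Qed.

(** Coset representative: for [s] fixing everything above [k], it agrees with [s] at [k], because
    products act from left to right. *)
Definition top_descent k (s : PermGroup) : PermGroup :=
  descent adj (s (inord k)) (k - s (inord k)).

Lemma fixes_from_top k (s : PermGroup) : k < 18 -> fixes_from k.+1 s ->
  fixes_from k (s ** ginv (top_descent k s)).
Proof.
move=> k18 sk j kj j18; have sb := fixes_from_bound k18 sk.
rewrite permgroupM; apply: (canLR (permK _)).
have [jk|jk] : j = k \/ k < j by lia.
  have := @descent_adj_last (s (inord k)) (k - s (inord k)).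
  by rewrite subnKC // inord_val jk => ->.
by rewrite sk // descent_adj_fix //; lia.
Qed.

Lemma adj_ind (P : PermGroup -> Prop) : P gone ->
  (forall s i, i < 17 -> P s -> P (s ** adj i)) -> forall s, P s.
Proof.
move=> P1 PM; have Pd s m d : m + d < 18 -> P s -> P (s ** descent adj m d).
  elim: d m => [|d IH] m md Ps; first by rewrite gmulr1.
  by rewrite descentSr gmulA; apply: PM; [lia | apply: IH; [lia |]].
suff Pk k s : k <= 18 -> fixes_from k s -> P s by move=> s; apply: (@Pk 18) => // j; lia.
elim: k s => [|k IH] s k18 sk.
  rewrite (_ : s = gone) //; apply/permP => j.
  by have := sk j; rewrite inord_val perm1; apply.
rewrite -(gmulVK s (top_descent k s)); apply: Pd.
  by rewrite subnKC //; apply: fixes_from_bound.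
by apply: IH; [lia | apply: fixes_from_top].
Qed.

Section CoxeterHom.
Variables (G : agroup) (t : nat -> G).
Hypothesis cox : coxeter 17 t.

(** Coset normal form: peel off the top descent, recurse into the smaller symmetric group, and read
    the same word in the generators [t]. *)
Fixpoint cox_nf (k : nat) (s : PermGroup) : G :=
  if k is k'.+1 then
    cox_nf k' (s ** ginv (top_descent k' s))
      ** descent t (s (inord k')) (k' - s (inord k'))
  else gone.

Lemma cox_nfS k s : cox_nf k.+1 s = cox_nf k (s ** ginv (top_descent k s))
  ** descent t (s (inord k)) (k - s (inord k)).
Proof. by []. Qed.

Lemma cox_nf1 k : k <= 18 -> cox_nf k gone = gone.
Proof.
elim: k => // k IH k18; rewrite cox_nfS /top_descent !perm1 inordK // subnn.
by rewrite gmulr1 gmulrV IH // ltnW.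
Qed.

Lemma cox_nf_adj k s i : k <= 18 -> fixes_from k s -> i.+1 < k ->
  cox_nf k (s ** adj i) = cox_nf k s ** t i.
Proof.
elim: k s i => // k IH s i k18 sk ik.
have mk := fixes_from_bound k18 sk; have sk' := fixes_from_top k18 sk.
rewrite !cox_nfS /top_descent permgroupM; rewrite /top_descent in sk'.
set m := s (inord k) in mk sk' *; have em : m = inord m by rewrite inord_val.
have i17 : i < 17 by lia.
(* The four fates of the last descent: it commutes with [t i], gains the letter [t i], loses its
   last letter, or turns [t i] into [t i.-1]. In the outer cases the letter is left to the
   recursion. *)
have [im|[im|[im|im]]] : i.+1 < m \/ i.+1 = m \/ i = m \/ m < i by lia.
- rewrite {1 2 3 4}em adj_fix // ?inord_val; try lia.
  have c := descent_low adj_coxeter im (_ : m + (k - m) <= 17).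
  have c' := descent_low cox im (_ : m + (k - m) <= 17).
  rewrite -gmulA (gcommuteV (c _)); last lia.
  by rewrite gmulA IH //; [rewrite -!gmulA c' //; lia | lia | lia].
- have -> : adj i m = inord i by rewrite em -im /adj tpermR.
  rewrite inordK; last lia.
  have -> : k - i = (k - m).+1 by lia.
  by rewrite !descentSr im ginvM -!gmulA (gmulA (adj i)) gmulrV gmul1 !gmulA.
- have -> : adj i m = inord i.+1 by rewrite em im /adj tpermL.
  rewrite inordK; last lia.
  have -> : k - m = (k - i.+1).+1 by lia.
  rewrite -im !descentSr ginvM; case: (cox) => sq _ _.
  case: adj_coxeter => sqa _ _.
  by rewrite -!gmulA sq // gmulr1 (ginv_eq (sqa _ i17)).
- have -> : adj i m = m by rewrite em adj_fix //; lia.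
  have c := descent_mid adj_coxeter im (_ : i < m + (k - m)) (_ : m + (k - m) <= 17).
  have c' := descent_mid cox im (_ : i < m + (k - m)) (_ : m + (k - m) <= 17).
  rewrite -!gmulA c'; [|lia|lia].
  have -> : adj i ** ginv (descent adj m (k - m)) = ginv (descent adj m (k - m)) ** adj i.-1.
    apply: (@gmulI _ (descent adj m (k - m))); rewrite !gmulA gmulrV gmul1.
    by rewrite c ?gmulK //; lia.
  by rewrite gmulA IH //; [rewrite -!gmulA | lia | lia].
Qed.

Lemma coxeter_hom : exists f : PermGroup -> G,
  ghom f /\ forall i, i < 17 -> f (adj i) = t i.
Proof.
have nfS s i : i < 17 -> cox_nf 18 (s ** adj i) = cox_nf 18 s ** t i.
  by move=> i17; apply: cox_nf_adj => // j; lia.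
exists (cox_nf 18); split=> [s s'|i i17]; last first.
  by rewrite -[adj i]gmul1 nfS // cox_nf1 // gmul1.
elim/adj_ind: s' => [|s' i i17 IH]; first by rewrite cox_nf1 // !gmulr1.
by rewrite gmulA !nfS // IH gmulA.
Qed.

End CoxeterHom.

(** * The model: permutations acting on an integral Heisenberg group *)

Section Model.
Local Open Scope ring_scope.

Notation zvec := 'rV[int]_18.

Definition dot (a b : zvec) : int := (a *m b^T) 0 0.

Lemma dotDl a a' b : dot (a + a') b = dot a b + dot a' b.
Proof. by rewrite /dot mulmxDl mxE. Qed.

Lemma dotDr a b b' : dot a (b + b') = dot a b + dot a b'.
Proof. by rewrite /dot linearD mulmxDr mxE. Qed.

Lemma dotZl k a b : dot (k *: a) b = k * dot a b.
Proof. by rewrite /dot -scalemxAl mxE. Qed.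

Lemma dotZr k a b : dot a (k *: b) = k * dot a b.
Proof. by rewrite /dot linearZ /= -scalemxAr mxE. Qed.

Lemma dotNr a b : dot a (- b) = - dot a b.
Proof. by rewrite /dot linearN mulmxN mxE. Qed.

Lemma dot0l b : dot 0 b = 0.
Proof. by rewrite /dot mul0mx mxE. Qed.

Lemma dot0r a : dot a 0 = 0.
Proof. by rewrite /dot linear0 mulmx0 mxE. Qed.

Lemma dot_delta (a : zvec) i : dot a (delta_mx 0 i) = a 0 i.
Proof. by rewrite /dot trmx_delta -colE mxE. Qed.

Lemma dot_perm (s : {perm 'I_18}) a b : dot (a *m perm_mx s) (b *m perm_mx s) = dot a b.
Proof.
by rewrite /dot trmx_mul -mulmxA (mulmxA (perm_mx s)) tr_perm_mx -perm_mxM mulgV perm_mx1 mul1mx.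
Qed.

(** [Smod s a b c] stands for [s], [x^a], [y^b], [z^c] multiplied in this order. The whole
    Heisenberg group is allowed here; C will be the part where [a] and [b] have sum zero. *)
Record smod := Smod { sperm : {perm 'I_18}; sx : zvec; sy : zvec; sz : int }.

Lemma smod_eq m m' : sperm m = sperm m' -> sx m = sx m' -> sy m = sy m' ->
  sz m = sz m' -> m = m'.
Proof. by case: m m' => [s a b c] [s' a' b' c'] /= -> -> -> ->. Qed.

Definition smul m m' := Smod (sperm m * sperm m')%g
  (sx m *m perm_mx (sperm m') + sx m') (sy m *m perm_mx (sperm m') + sy m')
  (sz m + sz m' - dot (sx m') (sy m *m perm_mx (sperm m'))).

Definition sone := Smod 1%g 0 0 0.

Definition sinv m := Smod (sperm m)^-1%g (- (sx m *m perm_mx (sperm m)^-1))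
  (- (sy m *m perm_mx (sperm m)^-1)) (- sz m - dot (sx m) (sy m)).

Lemma smulA m1 m2 m3 : smul m1 (smul m2 m3) = smul (smul m1 m2) m3.
Proof.
apply: smod_eq; rewrite /= ?mulgA // ?perm_mxM ?mulmxA ?mulmxDl ?addrA //.
by rewrite dotDl dotDr dot_perm; ring.
Qed.

Lemma smul1 m : smul sone m = m.
Proof.
by apply: smod_eq; rewrite /= ?mul1g ?mul0mx ?dot0r ?add0r // subr0.
Qed.

Lemma smulV m : smul (sinv m) m = sone.
Proof.
apply: smod_eq; rewrite /= ?mulVg //;
  rewrite !mulNmx -!mulmxA -!perm_mxM !mulVg !perm_mx1 !mulmx1 ?addNr //.
by rewrite dotNr; ring.
Qed.

Definition SModel : agroup := AGroup smulA smul1 smulV.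

Lemma smodel_mul (m m' : SModel) : m ** m' = Smod (sperm m * sperm m')%g
  (sx m *m perm_mx (sperm m') + sx m') (sy m *m perm_mx (sperm m') + sy m')
  (sz m + sz m' - dot (sx m') (sy m *m perm_mx (sperm m'))).
Proof. by []. Qed.

Definition slift (s : PermGroup) : SModel := Smod s 0 0 0.

Lemma slift_hom : ghom slift.
Proof.
by move=> s t; apply: smod_eq; rewrite //= ?mul0mx ?dot0l ?addr0 ?subr0.
Qed.

Definition sheis (a b : zvec) (c : int) : SModel := Smod 1%g a b c.

Lemma sheisM a b c a' b' c' :
  sheis a b c ** sheis a' b' c' = sheis (a + a') (b + b') (c + c' - dot a' b).
Proof. by apply: smod_eq; rewrite /= ?mulg1 // perm_mx1 !mulmx1. Qed.

Lemma slift_sheis s a b c : slift s ** sheis a b c = Smod s a b c :> SModel.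
Proof.
by apply: smod_eq; rewrite /= ?mulg1 ?mul0mx ?add0r ?dot0r ?subr0.
Qed.

Lemma sheis_conj s a b c :
  gconj (sheis a b c) (slift s) = sheis (a *m perm_mx s) (b *m perm_mx s) c.
Proof.
apply: gconj_eq; rewrite slift_sheis.
by apply: smod_eq; rewrite /= ?mul1g ?addr0 ?dot0l ?subr0.
Qed.

Definition dvec (p q : 'I_18) : zvec := delta_mx 0 q - delta_mx 0 p.

Lemma delta_perm (s : {perm 'I_18}) i :
  delta_mx 0 i *m perm_mx s = delta_mx 0 (s i) :> zvec.
Proof. by rewrite -rowE; apply/rowP => j; rewrite !mxE eqxx eq_sym. Qed.

Lemma dvec_perm (s : {perm 'I_18}) p q : dvec p q *m perm_mx s = dvec (s p) (s q).
Proof. by rewrite mulmxBl !delta_perm. Qed.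

Lemma dvecC p q : dvec q p = - dvec p q.
Proof. by rewrite opprB. Qed.

Lemma dot_dvec (a : zvec) p q : dot a (dvec p q) = a 0 q - a 0 p.
Proof. by rewrite dotDr dotNr !dot_delta. Qed.

Lemma dvecE p q i : dvec p q 0 i = (i == q)%:R - (i == p)%:R.
Proof. by rewrite !mxE. Qed.

(* The central coordinate is forced: it is the only one for which the element squares to 1. *)
Definition srefl (p q : 'I_18) (m n : int) : SModel :=
  Smod (tperm p q) (m *: dvec p q) (n *: dvec p q) (- (m * n)).

Lemma sreflC p q m n : srefl p q m n = srefl q p (- m) (- n).
Proof.
by rewrite /srefl (tpermC q p) (dvecC p q) !scalerN !scaleNr mulrNN !opprK.
Qed.

Lemma srefl_sq p q m n : p != q -> srefl p q m n ** srefl p q m n = gone.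
Proof.
move=> pq; rewrite smodel_mul; apply: smod_eq => /=; first by rewrite tperm2.
- by rewrite -scalemxAl dvec_perm tpermL tpermR (dvecC p q) scalerN addNr.
- by rewrite -scalemxAl dvec_perm tpermL tpermR (dvecC p q) scalerN addNr.
rewrite -scalemxAl dvec_perm tpermL tpermR (dvecC p q) scalerN.
rewrite dotZl dotNr dotZr dot_dvec !dvecE !eqxx (eq_sym q) (negPf pq) /=; ring.
Qed.

Lemma srefl_commute p q r s m n m' n' : p != r -> p != s -> q != r -> q != s ->
  gcommute (srefl p q m n) (srefl r s m' n').
Proof.
move=> pr ps qr qs; rewrite /gcommute !smodel_mul; apply: smod_eq => /=.
- by rewrite -[in RHS](tpermJ_id pr ps qr qs) -conjgC.
- by rewrite -!scalemxAl !dvec_perm !tpermD // 1?eq_sym // addrC.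
- by rewrite -!scalemxAl !dvec_perm !tpermD // 1?eq_sym // addrC.
rewrite -!scalemxAl !dvec_perm !tpermD // 1?eq_sym //.
rewrite !(dotZl, dotZr) !dot_dvec !dvecE !(eq_sym s, eq_sym r).
by rewrite (negPf pr) (negPf ps) (negPf qr) (negPf qs) /=; ring.
Qed.

(** Displacements add along the path [p], [q], [r]. This formula yields both (R3) and the sliding
    behind (R4). *)
Lemma srefl_braid p q r m n m' n' : p != q -> q != r -> p != r ->
  srefl p q m n ** srefl q r m' n' ** srefl p q m n = srefl p r (m + m') (n + n').
Proof.
move=> pq qr pr; rewrite !smodel_mul; apply: smod_eq => /=.
- by rewrite tperm_braid.
- rewrite -!scalemxAl mulmxDl -!scalemxAl !dvec_perm !(tpermL, tpermR).
  rewrite !(@tpermD _ q r p) ?(@tpermD _ p q r) //; try by rewrite eq_sym.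
  by apply/rowP => k; rewrite tpermL !mxE; ring.
- rewrite -!scalemxAl mulmxDl -!scalemxAl !dvec_perm !(tpermL, tpermR).
  rewrite !(@tpermD _ q r p) ?(@tpermD _ p q r) //; try by rewrite eq_sym.
  by apply/rowP => k; rewrite tpermL !mxE; ring.
rewrite -!scalemxAl mulmxDl -!scalemxAl !dvec_perm !(tpermL, tpermR).
rewrite !(@tpermD _ q r p) ?(@tpermD _ p q r) //; try by rewrite eq_sym.
rewrite ?tpermL [dot (m *: dvec p q) _]dotDr !(dotZl, dotZr) !dot_dvec !dvecE !eqxx.
rewrite !(eq_sym q p) !(eq_sym r p) !(eq_sym r q).
by rewrite (negPf pq) (negPf qr) (negPf pr) /=; ring.
Qed.

End Model.

(** * Incidences of the graph *)

(** The bounds exclude collisions: [vtx 0] is [vtx 1], and labels above 18 fall on the default value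
    of [inord]. *)
Lemma vtx_eq a b : 0 < a <= 18 -> 0 < b <= 18 -> (vtx a == vtx b) = (a == b).
Proof. by move=> ha hb; rewrite inord_eq; lia. Qed.

Lemma vtxK (i : 'I_18) : vtx i.+1 = i.
Proof. by rewrite /vtx /= inord_val. Qed.

Lemma vtx_neq a b : [&& 0 < a <= 18, 0 < b <= 18 & a != b] -> vtx a != vtx b.
Proof. by case/and3P=> ha hb ab; rewrite vtx_eq. Qed.

Lemma edg_val k : 0 < k <= 27 -> edg k = k.-1 :> nat.
Proof. by move=> hk; rewrite inordK //; lia. Qed.

Definition edge_of (k : nat) := nth (0, 0) edges k.-1.

Lemma edges_bound (j : nat) : j < 27 ->
  let e := nth (0, 0) edges j in [&& 0 < e.1 <= 18, 0 < e.2 <= 18 & e.1 != e.2].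
Proof.
have : all (fun e => [&& 0 < e.1 <= 18, 0 < e.2 <= 18 & e.1 != e.2]) edges by [].
by move=> /(all_nthP (0, 0)) h j27; apply: h.
Qed.

Lemma ep_neq j : ep1 j != ep2 j.
Proof. exact/vtx_neq/edges_bound/ltn_ord. Qed.

(** [share] transferred to zero-based natural numbers, where incidences can be decided by
    evaluation. *)
Definition shareN (i j : nat) : bool :=
  let e := nth (0, 0) edges i in let e' := nth (0, 0) edges j in
  [|| e.1 == e'.1, e.1 == e'.2, e.2 == e'.1 | e.2 == e'.2].

Lemma shareE (i j : 'I_27) : share i j = shareN i j.
Proof.
have [/and3P[a1 a2 _] /and3P[b1 b2 _]] :=
  (edges_bound (ltn_ord i), edges_bound (ltn_ord j)).
by rewrite /share /ep1 /ep2 !vtx_eq.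
Qed.

Lemma share_edg a b : 0 < a <= 27 -> 0 < b <= 27 ->
  share (edg a) (edg b) = shareN a.-1 b.-1.
Proof. by move=> ha hb; rewrite shareE !edg_val. Qed.

(** T has no parallel edges, so two edges meeting at a vertex involve three distinct vertices, as
    [srefl_braid] requires. *)
Lemma ep_simple (i j : 'I_27) : i != j ->
  ~~ ((ep1 i == ep1 j) && (ep2 i == ep2 j)) && ~~ ((ep1 i == ep2 j) && (ep2 i == ep1 j)).
Proof.
have [/and3P[a1 a2 _] /and3P[b1 b2 _]] :=
  (edges_bound (ltn_ord i), edges_bound (ltn_ord j)).
rewrite /ep1 /ep2 !vtx_eq // -val_eqE /=.
have : all (fun i => all (fun j => (i != j) ==>
    let e := nth (0, 0) edges i in let e' := nth (0, 0) edges j in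
    ~~ ((e.1 == e'.1) && (e.2 == e'.2)) && ~~ ((e.1 == e'.2) && (e.2 == e'.1)))
  (iota 0 27)) (iota 0 27) by vm_compute.
move=> /allP /(_ i); rewrite mem_iota ltn_ord => /(_ isT) /allP /(_ j).
by rewrite mem_iota ltn_ord => /(_ isT) /implyP.
Qed.

(* For an equivalence relation, it is enough to walk along a tree whose edges
   are listed so that each one leaves the part already reached. *)
Fixpoint grows (seen : seq nat) (es : seq (nat * nat)) : bool :=
  if es is e :: es' then (e.1 \in seen) && grows (e.2 :: seen) es' else true.

Lemma grows_rel (Q : 'I_18 -> 'I_18 -> Prop) (r : 'I_18) seen es :
  (forall a b c, Q a b -> Q b c -> Q a c) ->
  (forall v, v \in seen -> Q r (vtx v)) ->
  (forall e, e \in es -> Q (vtx e.1) (vtx e.2)) -> grows seen es ->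
  forall v, (v \in seen) || (v \in map snd es) -> Q r (vtx v).
Proof.
move=> Qt; elim: es seen => [|e es IH] seen Qs Qe /=.
  by move=> _ v; rewrite orbF; apply: Qs.
case/andP=> es1 gr v vin; apply: (IH (e.2 :: seen)) => //.
- move=> w; rewrite inE => /orP[/eqP->|]; last exact: Qs.
  by apply: Qt (Qs _ es1) (Qe _ _); rewrite mem_head.
- by move=> e' e'in; apply: Qe; rewrite inE e'in orbT.
by move: vin; rewrite !inE orbCA orbA.
Qed.

(** * The reflections of the model satisfy the relations of [C] *)

Section ModelRelations.
Local Open Scope ring_scope.

(* Displacement in the universal cover of the torus along each edge, oriented
   from the first to the second listed endpoint; it vanishes along the
   Hamiltonian path [hpath] below. *)
Definition volts : seq (int * int) :=
  [:: (0, 0); (0, 0); (0, 0); (-1, 0); (0, 0); (0, 0); (0, 0); (0, 1); (0, 0);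
      (0, 0); (0, 0); (0, 0); (1, 0); (0, 0); (-1, 1); (0, 0); (0, 0); (0, 0);
      (0, 0); (0, 0); (0, 0); (0, 0); (0, 0); (0, 1); (0, 0); (0, -1); (0, 0)].

Definition sgen (j : 'I_27) : SModel :=
  srefl (ep1 j) (ep2 j) (nth (0, 0) volts j).1 (nth (0, 0) volts j).2.

Lemma srefl_slide p q r m n m' n' : p != q -> q != r -> p != r ->
  srefl p q m n ** srefl q r m' n' = srefl q r m' n' ** srefl p r (m + m') (n + n').
Proof.
move=> pq qr pr; apply: (@gmulI _ (srefl q r m' n')).
rewrite [RHS]gmulA srefl_sq // gmul1 (sreflC q r) (sreflC p q) gmulA.
rewrite srefl_braid 1?eq_sym // sreflC; congr srefl; ring.
Qed.

Lemma srefl_braid_sym p q r m n m' n' : p != q -> q != r -> p != r ->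
  srefl p q m n ** srefl q r m' n' ** srefl p q m n
  = srefl q r m' n' ** srefl p q m n ** srefl q r m' n'.
Proof.
move=> pq qr pr; rewrite srefl_braid // -[RHS]gmulA srefl_slide //.
by rewrite gmulA srefl_sq // gmul1.
Qed.

Definition ovolt (k x y : nat) : int * int :=
  let v := nth (0, 0) volts k.-1 in
  if edge_of k == (x, y) then v else (- v.1, - v.2).

Lemma sgen_orient k x y : [&& 0 < k <= 27 & (edge_of k == (x, y)) || (edge_of k == (y, x))]%N ->
  sgen (edg k) = srefl (vtx x) (vtx y) (ovolt k x y).1 (ovolt k x y).2.
Proof.
case/andP=> k27; rewrite /sgen /ovolt /ep1 /ep2 !edg_val // -/(edge_of k).
case: eqP => [-> //|_ /= /eqP ->] /=.
exact: sreflC.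
Qed.

Lemma sgen_braid i j : i != j -> share i j ->
  sgen i ** sgen j ** sgen i = sgen j ** sgen i ** sgen j.
Proof.
move=> ij sh; have /andP[n1 n2] := ep_simple ij.
have ni := ep_neq i; have nj := ep_neq j; rewrite /sgen.
case/or4P: sh => /eqP e; rewrite e ?eqxx ?andbT /= in ni n1 n2 *.
- by rewrite (sreflC _ (ep2 i)) srefl_braid_sym // eq_sym.
- rewrite (sreflC _ (ep2 i)) (sreflC (ep1 j)) srefl_braid_sym // eq_sym //.
- by rewrite srefl_braid_sym.
- by rewrite (sreflC (ep1 j)) srefl_braid_sym // eq_sym.
Qed.

(** The first reflection slides past the other four in turn; its far end travels from [p2] to [p6]
    and its displacement accumulates. *)
Lemma srefl_hexagon p1 p2 p3 p4 p5 p6 m1 m2 m3 m4 m5 n1 n2 n3 n4 n5 :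
  uniq [:: p1; p2; p3; p4; p5; p6] ->
  srefl p1 p2 m1 n1 ** srefl p2 p3 m2 n2 ** srefl p3 p4 m3 n3 ** srefl p4 p5 m4 n4
    ** srefl p5 p6 m5 n5
  = srefl p2 p3 m2 n2 ** srefl p3 p4 m3 n3 ** srefl p4 p5 m4 n4 ** srefl p5 p6 m5 n5
    ** srefl p1 p6 (m1 + m2 + m3 + m4 + m5) (n1 + n2 + n3 + n4 + n5).
Proof.
rewrite /= !inE !negb_or -!andbA => /and5P[? ? ? ? /and5P[? ? ? ? /and5P[? ? ? ? /and4P[? ? ? _]]]].
rewrite (@srefl_slide p1) // -(gmulA _ _ (srefl p3 p4 _ _)) (@srefl_slide p1) // gmulA.
rewrite -(gmulA _ _ (srefl p4 p5 _ _)) (@srefl_slide p1) // gmulA.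
by rewrite -(gmulA _ _ (srefl p5 p6 _ _)) (@srefl_slide p1) // gmulA.
Qed.

(** The last test carries the geometry: the displacements around the hexagon cancel, that is, it
    lifts to a closed walk in the plane. *)
Definition hex_walk (h ps : seq nat) : bool :=
  let k i := nth 0%N h i in let p i := nth 0%N ps i in
  let ok i x y := [&& 0 < k i <= 27 & (edge_of (k i) == (x, y)) || (edge_of (k i) == (y, x))]%N in
  let w i := ovolt (k i) (p i) (p i.+1) in
  [&& ok 0%N (p 0) (p 1), ok 1%N (p 1) (p 2), ok 2 (p 2) (p 3), ok 3 (p 3) (p 4),
      ok 4 (p 4) (p 5), ok 5 (p 0) (p 5), size ps == 6,
      uniq ps, all (fun v => 0 < v <= 18)%N ps &
      ovolt (k 5) (p 0) (p 5) ==
        ((w 0%N).1 + (w 1%N).1 + (w 2).1 + (w 3).1 + (w 4).1,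
         (w 0%N).2 + (w 1%N).2 + (w 2).2 + (w 3).2 + (w 4).2)].

Lemma sgen_hexagon h ps : hex_walk h ps -> hex_rel sgen h.
Proof.
case/and5P=> k0 k1 k2 k3 /and5P[k4 k5 /eqP s6 up /andP[bp /eqP e]].
rewrite /hex_rel (sgen_orient k0) (sgen_orient k1) (sgen_orient k2).
rewrite (sgen_orient k3) (sgen_orient k4) (sgen_orient k5) e srefl_hexagon //.
have -> : [:: vtx (nth 0 ps 0); vtx (nth 0 ps 1); vtx (nth 0 ps 2); vtx (nth 0 ps 3);
              vtx (nth 0 ps 4); vtx (nth 0 ps 5)]%N = map vtx ps.
  by case: ps s6 {up bp e k0 k1 k2 k3 k4 k5} => [|p1 [|p2 [|p3 [|p4 [|p5 [|p6 [|]]]]]]].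
rewrite map_inj_in_uniq // => x y /(allP bp) bx /(allP bp) by' /eqP.
by rewrite vtx_eq // => /eqP.
Qed.

Lemma sgen_CRel : CRel sgen.
Proof.
split=> [j|i j nsh|i j|h].
- exact/srefl_sq/ep_neq.
- by move: nsh; rewrite /share !negb_or => /and4P[*]; apply: srefl_commute.
- exact: sgen_braid.
rewrite !inE => /or4P[/eqP->|/eqP->|/eqP->|].
(* The witness lists the vertices so that consecutive ones are joined by the first five edges, and
   the first and last ones by the sixth. *)
- by apply: (@sgen_hexagon _ [:: 13; 1; 3; 2; 7; 15]%N).
- by apply: (@sgen_hexagon _ [:: 7; 2; 6; 4; 9; 11]%N).
- by apply: (@sgen_hexagon _ [:: 9; 4; 5; 1; 13; 17]%N).
case/or4P=> [/eqP->|/eqP->|/eqP->|/or3P[/eqP->|/eqP->|/eqP->]].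
- by apply: (@sgen_hexagon _ [:: 5; 8; 12; 10; 3; 1]%N).
- by apply: (@sgen_hexagon _ [:: 3; 10; 18; 14; 6; 2]%N).
- by apply: (@sgen_hexagon _ [:: 6; 14; 16; 8; 5; 4]%N).
- by apply: (@sgen_hexagon _ [:: 16; 15; 7; 11; 12; 8]%N).
- by apply: (@sgen_hexagon _ [:: 12; 11; 9; 17; 18; 10]%N).
- by apply: (@sgen_hexagon _ [:: 18; 17; 13; 15; 16; 14]%N).
Qed.

(* Along [T0] the displacements are the increments of [pot], so conjugation by
   the corresponding Heisenberg element turns the reflections indexed by [T0]
   into plain transpositions. *)
Definition pot : 'rV[int]_18 :=
  \row_i (if i.+1 \in [:: 1; 2; 3; 4; 5; 6; 8; 14; 16]%N then -1 else 0).

Definition gauge : SModel := sheis 0 pot 0.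

Lemma pot_vtx v : (0 < v <= 18)%N ->
  pot 0 (vtx v) = if v \in [:: 1; 2; 3; 4; 5; 6; 8; 14; 16]%N then -1 else 0.
Proof. by move=> hv; rewrite mxE inordK ?prednK //; lia. Qed.

Lemma tperm_row (a : 'rV[int]_18) p q :
  a *m perm_mx (tperm p q) = a - (a 0 q - a 0 p) *: dvec p q.
Proof.
have -> : a *m perm_mx (tperm p q) = col_perm (tperm p q) a by rewrite col_permE tpermV.
apply/rowP=> k; rewrite !mxE; case: (tpermP p q k) => [->|->|/eqP kp /eqP kq].
- by rewrite !eqxx; case: eqVneq => [->|_] /=; ring.
- by rewrite !eqxx; case: eqVneq => [->|_] /=; ring.
- by rewrite (negPf kp) (negPf kq) /=; ring.
Qed.

(** [gauge] has no [x] part because no edge of [T0] is displaced in that direction; conjugating a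
    transposition by it creates the displacement [pot q - pot p]. *)
Lemma gauge_srefl p q : p != q ->
  gauge ** srefl p q 0 (pot 0 q - pot 0 p) = slift (tperm p q) ** gauge.
Proof.
move=> pq; rewrite slift_sheis smodel_mul; apply: smod_eq => /=.
- by rewrite mul1g.
- by rewrite mul0mx scale0r addr0.
- by rewrite tperm_row subrK.
- by rewrite scale0r dot0l mul0r !oppr0 !addr0.
Qed.

Lemma gauge_sgen j : j \in T0 -> gauge ** sgen j = slift (tperm (ep1 j) (ep2 j)) ** gauge.
Proof.
case/mapP=> k kin ->.
pose p v : int := if v \in [:: 1; 2; 3; 4; 5; 6; 8; 14; 16]%N then -1 else 0.
have : all (fun k => (0 < k <= 27)%N &&
    (nth (0, 0) volts k.-1 == (0, p (edge_of k).2 - p (edge_of k).1)))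
  [:: 5; 6; 8; 9; 11; 12; 14; 16; 18; 19; 20; 21; 22; 24; 25; 26; 27]%N by vm_compute.
move=> /allP /(_ k kin) /andP[k27 /eqP ek].
have kv := edg_val k27; have := edges_bound (ltn_ord (edg k)).
rewrite kv -/(edge_of k) => /and3P[b1 b2 _].
rewrite -gauge_srefl ?ep_neq // /sgen {1 2}/ep1 {1}/ep2 kv ek /= /p -!pot_vtx //.
by rewrite /ep1 /ep2 kv.
Qed.

Lemma T0_transitive (Q : 'I_18 -> 'I_18 -> Prop) :
  (forall a, Q a a) -> (forall a b, Q a b -> Q b a) ->
  (forall a b c, Q a b -> Q b c -> Q a c) ->
  (forall j, j \in T0 -> Q (ep1 j) (ep2 j)) -> forall a b, Q a b.
Proof.
move=> Qr Qs Qt QT.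
(* The edges of [T0], oriented away from vertex 1 and listed in an order accepted by [grows]. *)
pose es := [:: (1, 5); (5, 8); (8, 16); (16, 14); (14, 18); (18, 10); (10, 3); (3, 2);
  (10, 12); (12, 11); (11, 7); (14, 6); (6, 4); (16, 15); (15, 13); (18, 17); (17, 9)]%N.
pose T0n := [:: 5; 6; 8; 9; 11; 12; 14; 16; 18; 19; 20; 21; 22; 24; 25; 26; 27]%N.
have Qe e : e \in es -> Q (vtx e.1) (vtx e.2).
  have : all (fun e => has (fun k => [&& 0 < k <= 27 &
     (edge_of k == e) || (edge_of k == (e.2, e.1))])%N T0n) es by [].
  move=> /allP h /h /hasP[k kT /andP[k27 ek]].
  have := QT (edg k) (map_f _ kT); rewrite /ep1 /ep2 edg_val // -/(edge_of k).
  by case/orP: ek => /eqP -> //=; apply: Qs.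
have Q1 v : Q (vtx 1) v.
  have : all (fun v => (v \in [:: 1]) || (v \in map snd es))%N (iota 1 18) by [].
  have vi : (nat_of_ord v).+1 \in iota 1 18 by rewrite mem_iota; have := ltn_ord v; lia.
  move=> /allP /(_ _ vi) vin.
  rewrite -(vtxK v); apply: (@grows_rel Q _ [:: 1%N] es) => //.
  by move=> w; rewrite inE => /eqP ->.
by move=> a b; apply: Qt (Q1 b); apply: Qs.
Qed.

End ModelRelations.

(** * Groups over the symmetric group: equivariant families of involutions *)

Lemma perm_map_exists (T : finType) (s t : seq T) : uniq s -> uniq t -> size s = size t ->
  exists f : {perm T}, map f s = t.
Proof.
elim: s t => [|a s IH] [|b t] //=; first by exists 1%g.
case/andP=> as_ us /andP[bt ut] [/(IH _ us ut) [f ft]].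
exists (f * tperm (f a) b)%g; rewrite permM tpermL; congr (_ :: _).
rewrite -[RHS]ft; apply/eq_in_map => x xs; rewrite permM tpermD //.
  by rewrite (inj_eq perm_inj); apply: contraNneq as_ => ->.
by apply: contraNneq bt => ->; rewrite -ft map_f.
Qed.

Lemma fresh_ord (s : seq 'I_18) : size s < 18 -> exists k, k \notin s.
Proof.
move=> ss; have [k kP|all_s] := pickP [pred k | k \notin s]; first by exists k.
have : #|'I_18| <= size s.
  apply: leq_trans (card_size s); apply/subset_leq_card/subsetP => x _.
  by have /= /negbFE := all_s x.
by rewrite card_ord leqNgt ss.
Qed.

(** The pointwise stabiliser of [F] is generated by transpositions off [F]: right multiplication by
    [tperm x (s x)] makes [x] a fixed point and shrinks the support. *)
Lemma perm_fix_ind (T : finType) (F : {set T}) (P : {perm T} -> Prop) :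
  P 1%g ->
  (forall s x y, P s -> x \notin F -> y \notin F -> P (s * tperm x y)%g) ->
  forall s : {perm T}, {in F, forall x, s x = x} -> P s.
Proof.
move=> P1 PM s; have [n] := ubnP #|[set x | s x != x]|.
elim: n s => // n IH s; rewrite ltnS => sn sF.
have [x sx|s1] := pickP [pred x | s x != x]; last first.
  rewrite (_ : s = 1%g) //; apply/permP => x; rewrite perm1.
  by have /= /negbFE/eqP := s1 x.
rewrite /= in sx.
have xF : x \notin F by apply: contraNN sx => /sF/eqP.
have sxF : s x \notin F.
  by apply: contraNN sx => /sF/perm_inj/eqP.
rewrite -(mulgK (tperm x (s x)) s) tpermV; apply: PM => //; apply: IH.
  apply: leq_trans sn; apply: proper_card; apply/properP; split.
    apply/subsetP => y; rewrite !inE permM; apply: contraNN => /eqP sy.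
    rewrite sy tpermD //; first by apply: contraNneq sx => ->; rewrite sy.
    by rewrite -[in X in _ != X]sy (inj_eq perm_inj); apply: contraNneq sx => ->; rewrite sy.
  by exists x; rewrite !inE ?permM ?tpermR ?eqxx.
move=> y yF; rewrite permM (sF y yF) tpermD //.
  by apply: contraNneq xF => ->.
by apply: contraNneq sxF => ->.
Qed.

Section Families.
Variables (G : agroup) (iota : PermGroup -> G).
Hypothesis iotaM : ghom iota.

Definition tau p q : G := iota (tperm p q).

Lemma tauC p q : tau p q = tau q p.
Proof. by rewrite /tau tpermC. Qed.

Lemma tau_sq p q : tau p q ** tau p q = gone.
Proof. by rewrite /tau -iotaM /gmul /= tperm2; apply: (ghom1 iotaM). Qed.

Lemma tauV p q : ginv (tau p q) = tau p q.
Proof. exact/ginv_eq/tau_sq. Qed.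

Lemma tau_conj p q s : gconj (tau p q) (iota s) = tau (s p) (s q).
Proof. by rewrite /tau -(ghom_gconj iotaM) permgroup_conj tpermJ. Qed.

Lemma tau_braid p q r : uniq [:: p; q; r] -> tau p q ** tau q r ** tau p q = tau p r.
Proof.
rewrite /= !inE negb_or => /andP[/andP[pq pr] /andP[qr _]].
by rewrite /tau -!iotaM /gmul /= tperm_braid.
Qed.

(** Axioms for the reflections of one fixed displacement, indexed by ordered pairs. The last two say
    that a plain transposition, of displacement zero, may extend either end. *)
Definition refl_family (A : 'I_18 -> 'I_18 -> G) : Prop :=
  [/\ forall s p q, p != q -> gconj (A p q) (iota s) = A (s p) (s q),
      forall p q, p != q -> A p q ** A p q = gone,
      forall p q r, uniq [:: p; q; r] -> gconj (tau q r) (A p q) = A p r &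
      forall p q r, uniq [:: p; q; r] -> gconj (tau p r) (A p q) = A r q].

(** Conjugate [w] by any permutation carrying [p0, q0] to [p, q]; this is well defined as [w]
    commutes with their stabiliser. One braid relation at each end is enough, since [S_18] is
    transitive on ordered triples. *)
Lemma refl_family_exists (w : G) p0 q0 r1 r2 :
  uniq [:: p0; q0; r1] -> uniq [:: p0; q0; r2] -> w ** w = gone ->
  (forall r s, r \notin [:: p0; q0] -> s \notin [:: p0; q0] -> gcommute w (tau r s)) ->
  w ** tau q0 r1 ** w = tau q0 r1 ** w ** tau q0 r1 ->
  w ** tau p0 r2 ** w = tau p0 r2 ** w ** tau p0 r2 ->
  exists2 A, refl_family A & A p0 q0 = w.
Proof.
move=> u1 u2 ww wt br1 br2.
have stab (s : PermGroup) : s p0 = p0 -> s q0 = q0 -> gcommute w (iota s).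
  move=> sp sq; pose F := [set x in [:: p0; q0]].
  apply: (@perm_fix_ind _ F (fun s : PermGroup => gcommute w (iota s))).
  - by have -> : iota 1%g = gone by [apply: (ghom1 iotaM)]; apply: gcommute1.
  - move=> s' x y ws' xF yF.
    have -> : iota (s' * tperm x y)%g = iota s' ** tau x y by exact: iotaM.
    by rewrite /F !inE in xF yF; apply: gcommuteM => //; apply: wt; rewrite !inE.
  by move=> x; rewrite !inE => /orP[/eqP->|/eqP->].
have pq0 : p0 != q0 by move: u1; rewrite /= !inE negb_or => /andP[/andP[]].
pose sig p q := odflt 1%g [pick s : {perm 'I_18} | (s p0 == p) && (s q0 == q)].
have sigP p q : p != q -> sig p q p0 = p /\ sig p q q0 = q.
  move=> pq; rewrite /sig; case: pickP => [s /andP[/eqP-> /eqP->] //|none].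
  have [f [fp fq]] : exists f : {perm 'I_18}, map f [:: p0; q0] = [:: p; q].
    by apply: perm_map_exists; rewrite //= inE ?pq0 ?pq.
  by have := none f; rewrite fp fq !eqxx.
pose A p q := gconj w (iota (sig p q)).
have AE (s : PermGroup) p q : p != q -> s p0 = p -> s q0 = q -> gconj w (iota s) = A p q.
  move=> pq sp sq; have [gp gq] := sigP _ _ pq.
  rewrite -(gmulVK s (sig p q)) iotaM gconjMr; congr gconj.
  apply/gconj_id/stab; rewrite permgroupM ?sp ?sq.
    by apply: (canLR (permK _)); rewrite gp.
  by apply: (canLR (permK _)); rewrite gq.
have Aeqv s p q : p != q -> gconj (A p q) (iota s) = A (s p) (s q).
  move=> pq; have [gp gq] := sigP _ _ pq; rewrite /A -gconjMr -iotaM; apply: AE.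
  - by rewrite (inj_eq perm_inj).
  - by rewrite permgroupM gp.
  - by rewrite permgroupM gq.
have A0 : A p0 q0 = w.
  by rewrite -(AE 1%g) ?perm1 // (ghom1 iotaM : iota 1%g = gone) gconj1r.
have cw b : gconj b w = w ** b ** w by rewrite /gconj (ginv_eq ww).
exists A => //; split=> // [p q pq|p q r u|p q r u].
- by rewrite /A -gconjM ww gconj1.
- have [f [fp fq fr]] := perm_map_exists u1 u erefl.
  have n1 : p0 != r1 by move: u1; rewrite /= !inE negb_or => /andP[/andP[]].
  have n2 : q0 != r1 by move: u1; rewrite /= !inE negb_or => /andP[/andP[_ _] /andP[]].
  have AR0 : gconj (tau q0 r1) (A p0 q0) = A p0 r1.
    rewrite A0 cw br1 -(AE (tperm q0 r1)) ?tpermL ?tpermD // 1?eq_sym //.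
    by rewrite /gconj -/(tau q0 r1) tauV.
  rewrite -fp -fq -fr -Aeqv // -(Aeqv f p0 r1) // -AR0 -tau_conj.
  exact/esym/gconj_gconj.
- have [f [fp fq fr]] := perm_map_exists u2 u erefl.
  have n1 : p0 != r2 by move: u2; rewrite /= !inE negb_or => /andP[/andP[]].
  have n2 : q0 != r2 by move: u2; rewrite /= !inE negb_or => /andP[/andP[_ _] /andP[]].
  have AL0 : gconj (tau p0 r2) (A p0 q0) = A r2 q0.
    rewrite A0 cw br2 -(AE (tperm p0 r2)) ?tpermL ?tpermD // 1?eq_sym //.
    by rewrite /gconj -/(tau p0 r2) tauV.
  rewrite -fp -fq -fr -Aeqv // -(Aeqv f r2 q0) 1?eq_sym // -AL0 -tau_conj.
  exact/esym/gconj_gconj.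
Qed.

End Families.

(** * Translations and their central commutator *)

Section Shifts.
Variables (G : agroup) (iota : PermGroup -> G).
Hypothesis iotaM : ghom iota.
Notation tau := (tau iota).

(** The diagonal is set to the identity so that [shift_trans] holds for all triples. *)
Definition shift (A : 'I_18 -> 'I_18 -> G) p q : G :=
  if p == q then gone else tau p q ** A p q.

Section OneFamily.
Variable A : 'I_18 -> 'I_18 -> G.
Hypothesis Afam : refl_family iota A.
Notation X := (shift A).

Lemma shift_id p : X p p = gone.
Proof. by rewrite /shift eqxx. Qed.

Lemma shiftE p q : p != q -> X p q = tau p q ** A p q.
Proof. by rewrite /shift => /negPf ->. Qed.

Lemma refl_shift p q : p != q -> A p q = tau p q ** X p q.
Proof. by move=> pq; rewrite shiftE // gmulA tau_sq // gmul1. Qed.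

Lemma shift_conj p q s : gconj (X p q) (iota s) = X (s p) (s q).
Proof.
case: Afam => Aeqv _ _ _; rewrite /shift (inj_eq perm_inj).
by case: eqVneq => [_|pq]; rewrite ?gconj1 // gconjM tau_conj // Aeqv.
Qed.

Lemma shift_tau p q r s : gconj (X p q) (tau r s) = X (tperm r s p) (tperm r s q).
Proof. exact: shift_conj. Qed.

Lemma shiftV p q : ginv (X p q) = X q p.
Proof.
case: Afam => Aeqv Asq _ _; have [->|pq] := eqVneq p q; first by rewrite shift_id ginv1.
apply: ginv_eq; rewrite (shiftE pq) shiftE 1?eq_sym // (tauC iota q p).
have -> : A q p = gconj (A p q) (tau p q) by rewrite Aeqv // tpermL tpermR.
rewrite /gconj tauV // !gmulA -(gmulA _ (tau p q) (tau p q)) tau_sq // gmulr1.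
by rewrite -(gmulA _ _ (A p q)) Asq // gmulr1 tau_sq.
Qed.

(** The two sliding axioms give the product in the two orders, so consecutive translations
    commute. *)
Lemma shift_trans_neq p q r : uniq [:: p; q; r] ->
  X q r ** X p q = X p r /\ X p q ** X q r = X p r.
Proof.
move=> u; case: Afam => Aeqv Asq AR AL.
have n p' q' : p' != q' -> forall b, gconj b (A p' q') = A p' q' ** b ** A p' q'.
  by move=> ne b; rewrite /gconj (ginv_eq (Asq _ _ ne)).
have [pq pr qr] : [/\ p != q, p != r & q != r].
  by move: u; rewrite /= !inE negb_or => /andP[/andP[-> ->] /andP[-> _]].
have [qp rp rq] : [/\ q != p, r != p & r != q] by rewrite (eq_sym q) (eq_sym r p) (eq_sym r).
(* Collects the permutation parts on the left, where [tau_braid] evaluates them and [gmulI] cancels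
   them. *)
have mv (t x t' : G) : t ** x ** t' ** (t ** x) = t ** t' ** t ** (gconj x (t' ** t) ** x).
  by rewrite /gconj ginvM !gmulA !gmulK.
split.
  have := AR _ _ _ u; rewrite n // (refl_shift pq) (refl_shift pr) mv tau_braid //.
  move/gmulI <-; rewrite gconjMr !shift_tau tpermL (tpermD qp rp) tpermL.
  by rewrite (tpermD pr qr).
have u' : uniq [:: q; r; p] by rewrite /= !inE !negb_or qr qp rp.
have := AL _ _ _ u'; rewrite n // (refl_shift qr) (refl_shift pr) mv (tauC iota q r).
rewrite (tau_braid iotaM); last by rewrite /= !inE !negb_or rq rp qp.
rewrite (tauC iota r p); move/gmulI <-; rewrite gconjMr !shift_tau tpermL.
by rewrite (tpermD qr pr) tpermL (tpermD rp qp).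
Qed.

Lemma shift_trans p q r : X p q ** X q r = X p r.
Proof.
have [->|pq] := eqVneq p q; first by rewrite shift_id gmul1.
have [->|qr] := eqVneq q r; first by rewrite shift_id gmulr1.
have [<-|pr] := eqVneq p r; first by rewrite -(shiftV p q) gmulrV shift_id.
by apply: (proj2 (shift_trans_neq _)); rewrite /= !inE !negb_or pq pr qr.
Qed.

Lemma shift_commute p q r s : gcommute (X p q) (X r s).
Proof.
have tr a b c : gcommute (X a b) (X b c).
  have [->|ab] := eqVneq a b; first by rewrite shift_id; apply/gcommuteC/gcommute1.
  have [->|bc] := eqVneq b c; first by rewrite shift_id; apply/gcommute1.
  have [<-|ac] := eqVneq a c; first by rewrite /gcommute !shift_trans !shift_id.
  have [|e1 e2] := @shift_trans_neq a b c; first by rewrite /= !inE !negb_or ab ac bc.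
  by rewrite /gcommute e1 e2.
(* Split at [p], each factor of [X r s] is consecutive to [X p q] or to its inverse. *)
rewrite -(shift_trans r p s); apply: gcommuteM; first exact/gcommuteC/tr.
by rewrite -(shiftV q p); apply/gcommuteVl/tr.
Qed.

End OneFamily.

Section TwoFamilies.
Variables A B : 'I_18 -> 'I_18 -> G.
Hypothesis Afam : refl_family iota A.
Hypothesis Bfam : refl_family iota B.
Hypothesis AB_commute : forall p q r s, uniq [:: p; q; r; s] -> gcommute (A p q) (B r s).
(** Both sides stand for the reflection from [q] to [r] with displacement (-1, 1): through [p] on
    the left, through [s] on the right. *)
Hypothesis AB_conj : forall p q r s, uniq [:: p; q; r; s] ->
  gconj (B p r) (A p q) = gconj (B q s) (A r s).
Notation X := (shift A).
Notation Y := (shift B).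

Let uniq4P (p q r s : 'I_18) : uniq [:: p; q; r; s] ->
  [/\ [/\ p != q, p != r & p != s], [/\ q != r, q != s & r != s],
      [/\ q != p, r != p & s != p] & [/\ r != q, s != q & s != r]].
Proof.
rewrite /= !inE !negb_or -!andbA (eq_sym q p) (eq_sym r p) (eq_sym s p).
rewrite (eq_sym r q) (eq_sym s q) (eq_sym s r).
by case/and5P=> -> -> -> -> /and3P[-> -> _].
Qed.

Let A_tau p q r s : p != q -> gconj (A p q) (tau r s) = A (tperm r s p) (tperm r s q).
Proof. by case: Afam => h _ _ _; apply: h. Qed.

Let B_tau p q r s : p != q -> gconj (B p q) (tau r s) = B (tperm r s p) (tperm r s q).
Proof. by case: Bfam => h _ _ _; apply: h. Qed.

Lemma shifts_commute p q r s : uniq [:: p; q; r; s] -> gcommute (X p q) (Y r s).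
Proof.
move=> u; have [[pq pr ps] [qr qs rs] [qp rp sp] [rq sq sr]] := uniq4P u.
rewrite !shiftE //; apply: gcommuteM; apply: gcommuteMl.
- apply: gconj_idP; rewrite tau_conj //; congr (tau _ _); by rewrite tpermD.
- by apply: gconj_idP; rewrite A_tau // !tpermD.
- by apply/gcommuteC/gconj_idP; rewrite B_tau // !tpermD.
- exact: AB_commute.
Qed.

(** With [A p q = tau p q ** X p q], [AB_conj] says that [X p q] and [X r s] conjugate [B q r] to
    the same element, so [B q r] commutes with their quotient [W]. So does [tau q r], hence also
    [Y q r]. *)
Lemma shifts_commute2 p q r s : uniq [:: p; q; r; s] ->
  gcommute (X q p ** X r s) (Y q r).
Proof.
move=> u; have [[pq pr ps] [qr qs rs] [qp rp sp] [rq sq sr]] := uniq4P u.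
pose W := X p q ** X s r.
have BW : gcommute (B q r) W.
  apply: gconj_idP; have := AB_conj u.
  rewrite (refl_shift A pq) // (refl_shift A rs) // !gconjMr !B_tau //.
  rewrite tpermL (tpermD pr qr) tpermR (tpermD rq sq) => e.
  by rewrite e -gconjMr -(shiftV Afam r s) // gmulrV gconj1r.
have tW : gcommute W (tau q r).
  apply: gconj_idP; rewrite gconjM !shift_tau // !tpermR tpermL !tpermD //.
  rewrite -(shift_trans Afam p q r) -(shift_trans Afam s r q) /W -!gmulA; congr (_ ** _).
  rewrite (shift_commute Afam s r r q) gmulA (shift_trans Afam) //.
  by rewrite shift_id gmul1.
have YW : gcommute (Y q r) W.
  by rewrite shiftE //; apply: gcommuteMl => //; apply/gcommuteC.
have -> : X q p ** X r s = ginv W.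
  by rewrite /W ginvM !(shiftV Afam) // (shift_commute Afam).
exact/gcommuteC/gcommuteV.
Qed.

(** [X p a = X p k ** X k a], and [X k a] commutes with [Y p b], so an index can be exchanged for a
    fresh one; likewise for [Y]. *)
Lemma shifts_comm_indep p q s q' s' : uniq [:: p; q; s] -> uniq [:: p; q'; s'] ->
  gcomm (X p q) (Y p s) = gcomm (X p q') (Y p s').
Proof.
have E1 k a b : uniq [:: p; a; b; k] -> gcomm (X p a) (Y p b) = gcomm (X p k) (Y p b).
  move=> u; have [[pa pb pk] [ab ak bk] [ap bp kp] [ba ka kb]] := uniq4P u.
  rewrite -(shift_trans Afam p k a) (shift_commute Afam) gcomm_mull //.
  by apply: shifts_commute; rewrite /= !inE !negb_or ka kp kb ap ab pb.
have E2 k a b : uniq [:: p; a; b; k] -> gcomm (X p a) (Y p b) = gcomm (X p a) (Y p k).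
  move=> u; have [[pa pb pk] [ab ak bk] [ap bp kp] [ba ka kb]] := uniq4P u.
  rewrite -(shift_trans Bfam p k b) (shift_commute Bfam) gcomm_mulr //.
  by apply: shifts_commute; rewrite /= !inE !negb_or pa pk pb ak ab kb.
rewrite /= !inE !negb_or => /andP[/andP[pq ps] /andP[qs _]] /andP[/andP[pq' ps'] /andP[qs' _]].
have [k] := @fresh_ord [:: p; q; s; q'; s'] isT.
rewrite !inE !negb_or => /and5P[kp kq ks kq' ks'].
rewrite (E1 k q s) ?(E1 k q' s').
- have [->//|ss'] := eqVneq s s'; apply: E2.
  by rewrite /= !inE !negb_or (eq_sym p) kp ps ps' ks ks' ss'.
- by rewrite /= !inE !negb_or pq' ps' (eq_sym p) kp qs' eq_sym kq' eq_sym ks'.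
- by rewrite /= !inE !negb_or pq ps (eq_sym p) kp qs (eq_sym q) kq eq_sym ks.
Qed.

(* [zed p] plays the role of the commutator [x_p, y_p]. *)
Lemma zed_exists : exists zed : 'I_18 -> G,
  forall p q s, uniq [:: p; q; s] -> gcomm (X p q) (Y p s) = zed p.
Proof.
pose c p := [pick t : 'I_18 * 'I_18 | uniq [:: p; t.1; t.2]].
exists (fun p => if c p is Some t then gcomm (X p t.1) (Y p t.2) else gone) => p q s u.
rewrite /c; case: pickP => [t ut|/(_ (q, s))]; last by rewrite u.
exact: shifts_comm_indep.
Qed.

Section Centre.
Variable zed : 'I_18 -> G.
Hypothesis zedE : forall p q s, uniq [:: p; q; s] -> gcomm (X p q) (Y p s) = zed p.

(** Represent [zed p] with indices [q], [s] off [i] and [j]: both entries of the commutator then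
    commute with [X i j]. *)
Lemma zed_commuteX p i j : i != p -> j != p -> gcommute (X i j) (zed p).
Proof.
move=> ip jp; have [->|ij] := eqVneq i j; first by rewrite shift_id; apply/gcommuteC/gcommute1.
have [q] := @fresh_ord [:: p; i; j] isT; have [s] := @fresh_ord [:: p; i; j; q] isT.
rewrite !inE !negb_or => /and4P[sp si sj sq] /and3P[qp qi qj].
rewrite -(@zedE p q s); last by rewrite /= !inE !negb_or (eq_sym p) qp (eq_sym p) sp eq_sym sq.
apply: gcommute_gcomm; first exact: shift_commute.
by apply: shifts_commute; rewrite /= !inE !negb_or ij ip jp (eq_sym i) si (eq_sym j) sj eq_sym sp.
Qed.

Lemma zed_commuteY p i j : i != p -> j != p -> gcommute (Y i j) (zed p).
Proof.
move=> ip jp; have [->|ij] := eqVneq i j; first by rewrite shift_id; apply/gcommuteC/gcommute1.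
have [q] := @fresh_ord [:: p; i; j] isT; have [s] := @fresh_ord [:: p; i; j; q] isT.
rewrite !inE !negb_or => /and4P[sp si sj sq] /and3P[qp qi qj].
rewrite -(@zedE p q s); last by rewrite /= !inE !negb_or (eq_sym p) qp (eq_sym p) sp eq_sym sq.
apply: gcommute_gcomm; last exact: shift_commute.
apply/gcommuteC/shifts_commute.
by rewrite /= !inE !negb_or (eq_sym p) qp (eq_sym p i) ip (eq_sym p) jp qi qj ij.
Qed.

(** [Y q r] commutes with [X q p ** X r s] by [shifts_commute2]. Conjugation contributes [zed q]
    from the first factor and, as [Y q r] is the inverse of [Y r q], an inverse conjugate of [zed r]
    from the second. *)
Lemma zed_conj q r : q != r -> zed q = gconj (zed r) (Y q r).
Proof.
move=> qr; have [p] := @fresh_ord [:: q; r] isT; have [s] := @fresh_ord [:: q; r; p] isT.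
rewrite !inE !negb_or => /and3P[sq sr sp] /andP[pq pr].
have u : uniq [:: p; q; r; s].
  by rewrite /= !inE !negb_or pq pr qr (eq_sym p) sp (eq_sym q) sq (eq_sym r) sr.
have := gconj_id (shifts_commute2 u); rewrite gconjM.
have z1 : gcomm (X q p) (Y q r) = zed q.
  by apply: zedE; rewrite /= !inE !negb_or (eq_sym q) pq qr pr.
have z2 : gcomm (X r s) (Y r q) = zed r.
  by apply: zedE; rewrite /= !inE !negb_or (eq_sym r s) sr eq_sym qr sq.
have -> : gconj (X q p) (Y q r) = X q p ** zed q.
  by rewrite -z1 gcommE gmulA gmulrV gmul1.
rewrite -gmulA => /gmulI; have rq : r != q by rewrite eq_sym.
have zX : gcommute (X r s) (zed q) by apply: zed_commuteX.
have -> : gconj (X r s) (Y q r) = X r s ** ginv (gconj (zed r) (Y q r)).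
  rewrite -z2 -(shiftV Bfam r q) // /gconj /gcomm ginvK !ginvM !ginvK !gmulA.
  by rewrite gmulK gmulrV gmul1.
rewrite gmulA -zX -gmulA -[RHS]gmulr1 => /gmulI e.
by apply: (@gmulIr _ (ginv (gconj (zed r) (Y q r)))); rewrite e gmulrV.
Qed.

(** Compare through a third vertex [r]: [Y q r = Y q k ** Y k r], and [Y q k] commutes with
    [zed r]. *)
Lemma zed_const q k : zed q = zed k.
Proof.
have [->//|qk] := eqVneq q k; have [r] := @fresh_ord [:: q; k] isT.
rewrite !inE !negb_or => /andP[rq rk].
rewrite (@zed_conj q r) 1?eq_sym // (@zed_conj k r) 1?eq_sym //.
rewrite -(shift_trans Bfam q k r) gconjMr; congr gconj; apply/gconj_id/gcommuteC.
by apply: zed_commuteY; rewrite eq_sym.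
Qed.
End Centre.
End TwoFamilies.
End Shifts.

(** * The kernel of the abelianisation inside the model *)

Section Balanced.
Local Open Scope ring_scope.
Notation zvec := 'rV[int]_18.

Definition zsum (a : zvec) : Prop := a *m (const_mx 1 : 'cV_18) = 0.

Lemma zsumD a b : zsum a -> zsum b -> zsum (a + b).
Proof. by rewrite /zsum mulmxDl => -> ->; rewrite addr0. Qed.

Lemma zsumZ k a : zsum a -> zsum (k *: a).
Proof. by rewrite /zsum -scalemxAl => ->; rewrite scaler0. Qed.

Lemma zsum0 : zsum 0.
Proof. by rewrite /zsum mul0mx. Qed.

Lemma perm_const (s : {perm 'I_18}) :
  perm_mx s *m const_mx 1 = const_mx 1 :> 'cV[int]_18.
Proof. by rewrite -row_permE; apply/colP => i; rewrite !mxE. Qed.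

Lemma zsum_perm a (s : {perm 'I_18}) : zsum a -> zsum (a *m perm_mx s).
Proof. by rewrite /zsum -mulmxA perm_const. Qed.

Lemma zsum_dvec p q : zsum (dvec p q).
Proof.
rewrite /zsum mulmxBl -!rowE; apply/rowP => i.
by rewrite !mxE subrr.
Qed.

(** Projection onto the sum-zero vectors along the basis vector of [ord0]; [dmx *m dmx^T] is the
    Gram matrix of the vectors [dvec ord0 i]. *)
Definition dmx : 'M[int]_18 := \matrix_i dvec ord0 i.

Lemma zsum_dmx a : zsum a -> a *m dmx = a.
Proof.
move=> za; have -> : dmx = 1%:M - (const_mx 1 : 'cV_18) *m delta_mx 0 ord0.
  apply/row_matrixP => i; rewrite rowK linearB /= row1 row_mul.
  have -> : row i (const_mx 1 : 'cV[int]_18) = 1%:M.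
    by apply/rowP => k; rewrite !mxE ord1.
  by rewrite mul1mx.
by rewrite mulmxBr mulmx1 mulmxA za mul0mx subr0.
Qed.

Lemma zsum_decomp a : zsum a -> a = \sum_i a 0 i *: dvec ord0 i.
Proof.
move=> za; rewrite -{1}(zsum_dmx za) mulmx_sum_row; apply: eq_bigr => i _.
by rewrite rowK.
Qed.

Lemma heis_form_dmx a b : zsum a -> zsum b -> heis_form (dmx *m dmx^T) a b = dot a b.
Proof.
move=> za zb; rewrite /heis_form mulmxA (zsum_dmx za) -mulmxA.
by rewrite -trmx_mul (zsum_dmx zb).
Qed.

Lemma dmx_form i j : (dmx *m dmx^T) i j = dot (dvec ord0 i) (dvec ord0 j).
Proof.
rewrite /dot -[dvec ord0 i](rowK (fun i => dvec ord0 i)).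
by rewrite -[dvec ord0 j](rowK (fun i => dvec ord0 i)) !rowE trmx_mul -!mulmxA
  (mulmxA dmx) trmx_delta mulmxA -rowE -colE !mxE.
Qed.

Definition balanced (m : SModel) : Prop := zsum (sx m) /\ zsum (sy m).

Lemma balancedM (m m' : SModel) : balanced m -> balanced m' -> balanced (m ** m').
Proof.
by move=> [xm ym] [xm' ym']; split; apply: zsumD => //; apply: zsum_perm.
Qed.

Lemma balanced_slift s : balanced (slift s).
Proof. by split; apply: zsum0. Qed.

Lemma balanced_srefl p q m n : balanced (srefl p q m n).
Proof. by split; apply/zsumZ/zsum_dvec. Qed.

Lemma slift_srefl p q m n :
  slift (tperm p q) ** srefl p q m n = sheis (m *: dvec p q) (n *: dvec p q) (- (m * n)).
Proof.
have -> : srefl p q m n = slift (tperm p q) ** sheis (m *: dvec p q) (n *: dvec p q) (- (m * n)).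
  by rewrite slift_sheis.
rewrite gmulA -slift_hom; have -> : (tperm p q : PermGroup) ** tperm p q = gone by apply: tperm2.
by rewrite (ghom1 slift_hom) gmul1.
Qed.

Lemma balanced_ind (P : SModel -> Prop) :
  (forall m m', P m -> P m' -> P (m ** m')) -> (forall m, P m -> P (ginv m)) ->
  (forall s, P (slift s)) ->
  (forall p q, p != q -> P (srefl p q 1 0)) -> (forall p q, p != q -> P (srefl p q 0 1)) ->
  forall m, balanced m -> P m.
Proof.
move=> PM PV Ps PA PB [s a b c] [/= za zb].
have P1 : P gone by rewrite -(ghom1 slift_hom).
have PX p q : P (sheis (dvec p q) 0 0).
  have [->|pq] := eqVneq p q; first by rewrite /dvec subrr.
  have := slift_srefl p q 1 0; rewrite scale1r scale0r mulr0 oppr0 => <-.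
  by apply: PM; [apply: Ps | apply: PA].
have PY p q : P (sheis 0 (dvec p q) 0).
  have [->|pq] := eqVneq p q; first by rewrite /dvec subrr.
  have := slift_srefl p q 0 1; rewrite scale1r scale0r mul0r oppr0 => <-.
  by apply: PM; [apply: Ps | apply: PB].
have hx : @ghom (ZmodGroup zvec) SModel (fun a => sheis a 0 0).
  by move=> v w; rewrite sheisM dot0r !addr0.
have hy : @ghom (ZmodGroup zvec) SModel (fun b => sheis 0 b 0).
  by move=> v w; rewrite sheisM dot0l !addr0.
have hz : @ghom (ZmodGroup int) SModel (fun c => sheis 0 0 c).
  by move=> v w; rewrite sheisM dot0l !addr0.
have Ppow m k : P m -> P (gpow m k).
  by move=> Pm; elim: k => [|k IH|k IH] //; rewrite -addn1 PoszD ?opprD ?gpow_succ ?gpow_pred;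
     apply: PM => //; apply: PV.
have Psum (h : ZmodGroup zvec -> SModel) : ghom h -> (forall p q, P (h (dvec p q))) ->
    forall v, zsum v -> P (h v).
  move=> hM hd v /zsum_decomp ->; elim/big_ind: _ => [|v1 v2 h1 h2|i _].
  - by rewrite (ghom1 hM : h 0 = gone).
  - by rewrite (hM v1 v2 : h (v1 + v2) = _); apply: PM.
  - by rewrite -[v 0 i]intz scaler_int ghom_scale //; apply: Ppow.
have PZ : P (sheis 0 0 1).
  (* The vectors [dvec ord0 1] and [dvec ord0 2] have scalar product 1, so their commutator is [z]
     itself and not a proper power. *)
  have -> : sheis 0 0 1 = gcomm (sheis (dvec ord0 (inord 1)) 0 0) (sheis 0 (dvec ord0 (inord 2)) 0).
    apply/esym/gcomm_eq; rewrite !sheisM !dot0l dot_dvec !dvecE /= -!val_eqE /= !inordK //.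
    by rewrite !addr0 !add0r.
  exact: (PM _ _ (PM _ _ (PM _ _ (PV _ (PX _ _)) (PV _ (PY _ _))) (PX _ _)) (PY _ _)).
have -> : Smod s a b c = slift s ** (sheis a 0 0 ** sheis 0 b 0 ** sheis 0 0 c).
  by rewrite !sheisM slift_sheis !dot0l !oppr0 !addr0 !add0r.
apply: (PM _ _ (Ps s) (PM _ _ (PM _ _ (Psum _ hx _ _ za) (Psum _ hy _ _ zb)) _)) => //.
by have := ghom_scale hz 1 c; rewrite intz => ->; apply: Ppow.
Qed.

End Balanced.

(** * The normal form *)

Section NormalForm.
Local Open Scope ring_scope.
Variables (G : agroup) (iota : PermGroup -> G).
Hypothesis iotaM : ghom iota.
Variables A B : 'I_18 -> 'I_18 -> G.
Hypothesis Afam : refl_family iota A.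
Hypothesis Bfam : refl_family iota B.
Hypothesis AB_commute : forall p q r s, uniq [:: p; q; r; s] -> gcommute (A p q) (B r s).
Hypothesis AB_conj : forall p q r s, uniq [:: p; q; r; s] ->
  gconj (B p r) (A p q) = gconj (B q s) (A r s).
Notation X := (shift iota A).
Notation Y := (shift iota B).

(** As [zed] is constant, [X p q] can be tested against [zed r] with [r] off [p] and [q];
    permutations only relabel the commutator. *)
Lemma shifts_centre : exists Z : G,
  [/\ forall p q s, uniq [:: p; q; s] -> gcomm (X p q) (Y p s) = Z,
      forall p q, gcommute (X p q) Z, forall p q, gcommute (Y p q) Z &
      forall s, gcommute Z (iota s)].
Proof.
have [zed zedE] := zed_exists iotaM Afam Bfam AB_commute.
have zc := zed_const iotaM Afam Bfam AB_commute AB_conj zedE.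
exists (zed ord0); split=> [p q s u|p q|p q|s].
- by rewrite (zc _ p); apply: zedE.
- have [r] := @fresh_ord [:: p; q] isT; rewrite !inE negb_or => /andP[rp rq].
  by rewrite (zc _ r); apply: (zed_commuteX iotaM Afam Bfam AB_commute zedE); rewrite eq_sym.
- have [r] := @fresh_ord [:: p; q] isT; rewrite !inE negb_or => /andP[rp rq].
  by rewrite (zc _ r); apply: (zed_commuteY iotaM Afam Bfam AB_commute zedE); rewrite eq_sym.
- have [q] := @fresh_ord [:: ord0] isT; have [r] := @fresh_ord [:: ord0; q] isT.
  rewrite !inE negb_or => /andP[r0 rq] q0.
  have u : uniq [:: ord0; q; r].
    by rewrite /= !inE !negb_or (eq_sym _ q) q0 (eq_sym _ r) r0 eq_sym rq.
  apply: gconj_idP; rewrite -{1}(zedE _ _ _ u) gcomm_conj !shift_conj // (zc _ (s ord0)).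
  by apply: zedE; rewrite -[[:: _; _; _]]/(map s [:: ord0; q; r]) (map_inj_uniq perm_inj).
Qed.

Section WithCentre.
Variable Z : G.
Hypothesis XYZ : forall p q s, uniq [:: p; q; s] -> gcomm (X p q) (Y p s) = Z.
Hypothesis XZ : forall p q, gcommute (X p q) Z.
Hypothesis YZ : forall p q, gcommute (Y p q) Z.
Hypothesis iotaZ : forall s, gcommute Z (iota s).

Lemma shift_base i j :
  X ord0 i ** Y ord0 j = Y ord0 j ** X ord0 i ** gpow Z ((dmx *m dmx^T) i j).
Proof.
rewrite dmx_form dot_dvec !dvecE.
have [->|i0] := eqVneq i ord0.
  by rewrite shift_id !eqxx !subrr gmul1 !gmulr1.
have [->|j0] := eqVneq j ord0.
  by rewrite shift_id (eq_sym ord0 i) (negPf i0) !eqxx subrr gmulr1 gmul1 gmulr1.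
rewrite eqxx; have [->|ij] := eqVneq j i; last first.
  rewrite [X in gpow Z X](_ : _ = 1) // gpow1 (gcommP (X _ _)) (XYZ (q := i)) //.
  by rewrite /= !inE !negb_or (eq_sym _ i) i0 (eq_sym _ j) j0 eq_sym ij.
(* Diagonal case: splitting [X ord0 i] at a fresh [k], each half contributes one [Z]; 2 is the
   squared norm of [dvec ord0 i]. *)
rewrite [X in gpow Z X](_ : _ = 1 + 1) //.
have [k] := @fresh_ord [:: ord0; i] isT; rewrite !inE negb_or => /andP[k0 ki].
have c1 : gcomm (X ord0 k) (Y ord0 i) = Z.
  by apply: XYZ; rewrite /= !inE !negb_or (eq_sym _ k) k0 (eq_sym _ i) i0 ki.
have c2 : gcomm (X i k) (Y i ord0) = Z.
  by apply: XYZ; rewrite /= !inE !negb_or (eq_sym i) ki i0 k0.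
have c3 : gconj (X k i) (Y ord0 i) = X k i ** Z.
  have <- : gcomm (X k i) (Y ord0 i) = Z.
    by rewrite -(shiftV iotaM Afam i k) -(shiftV iotaM Bfam i ord0) gcommVV c2.
  by rewrite gcommE gmulA gmulrV gmul1.
rewrite gconjE -(shift_trans iotaM Afam ord0 k i) gconjM c3.
have -> : gconj (X ord0 k) (Y ord0 i) = X ord0 k ** Z.
  by rewrite -c1 gcommE gmulA gmulrV gmul1.
have -> : gpow Z (1 + 1) = Z ** Z by rewrite gpow_succ gpow1.
by rewrite -!gmulA; congr (_ ** (_ ** _)); rewrite !gmulA (XZ k i).
Qed.

Lemma gprodz_shift_conj (C : 'I_18 -> 'I_18 -> G) (s : PermGroup) (a : 'rV[int]_18) :
  refl_family iota C -> zsum a ->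
  gconj (gprodz (shift iota C ord0) a) (iota s)
  = gprodz (shift iota C ord0) (a *m perm_mx s).
Proof.
move=> Cfam za; have CC := shift_commute iotaM Cfam.
have hC := gprodz_hom (fun i j => CC ord0 i ord0 j).
(* [X ord0 i] is sent to [X (s ord0) (s i)], off by the inverse of [X ord0 (s ord0)]. Keeping this
   correction, trivial for sum zero, gives an identity additive on all vectors, which can then be
   checked on basis vectors. *)
rewrite -[RHS]gmulr1 -(_ : gpow (shift iota C ord0 (s ord0))
    (- (a *m (const_mx 1 : 'cV_18)) 0 0) = gone); last by rewrite za mxE oppr0.
move: a {za}; apply: ghom_rV_ext => [v w|v w|i].
- by rewrite hC gconjM.
- rewrite [(v ** w : ZmodGroup _)]/gmul /= !mulmxDl mxE opprD gpowD.
  rewrite (hC (v *m _) (w *m _) : gprodz _ (_ + _) = _) -!gmulA; congr (_ ** _).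
  rewrite !gmulA; congr (_ ** _); apply: gcommute_gpow.
  by apply/gcommuteC/gcommute_gprodz => j; apply: CC.
- rewrite delta_perm !gprodz_delta shift_conj // -rowE mxE mxE /=.
  by rewrite gmul1 (shiftV iotaM Cfam) CC (shift_trans iotaM Cfam).
Qed.

Definition nf (m : SModel) : G :=
  iota (sperm m) ** heis_nf (X ord0) (Y ord0) Z (sx m) (sy m) (sz m).

Lemma heis_nf_conj s a b c : zsum a -> zsum b ->
  gconj (heis_nf (X ord0) (Y ord0) Z a b c) (iota s)
  = heis_nf (X ord0) (Y ord0) Z (a *m perm_mx s) (b *m perm_mx s) c.
Proof.
move=> za zb; rewrite /heis_nf !gconjM (gprodz_shift_conj _ Afam za).
rewrite (gprodz_shift_conj _ Bfam zb); congr (_ ** _ ** _).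
by apply/gconj_id/gcommuteC/gcommute_gpow/gcommuteC.
Qed.

Lemma nfM m m' : balanced m -> balanced m' -> nf (m ** m') = nf m ** nf m'.
Proof.
move=> [xm ym] [xm' ym'].
have mv (p h p' h' : G) : p ** h ** (p' ** h') = p ** p' ** (gconj h p' ** h').
  by rewrite /gconj !gmulA gmulK.
rewrite /nf mv heis_nf_conj // -iotaM; congr (_ ** _).
rewrite (@heis_nfM _ _ (X ord0) (Y ord0) Z (dmx *m dmx^T)).
- by rewrite heis_form_dmx //; apply: zsum_perm.
- by move=> i j; apply: shift_commute.
- by move=> i j; apply: shift_commute.
- by move=> i; apply/gcommuteC.
- by move=> i; apply/gcommuteC.
- exact: shift_base.
Qed.

Lemma gprodz_shift0 (C : 'I_18 -> 'I_18 -> G) : refl_family iota C ->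
  gprodz (shift iota C ord0) 0 = gone.
Proof.
move=> Cfam; have CC := shift_commute iotaM Cfam.
exact: (ghom1 (gprodz_hom (fun i j => CC ord0 i ord0 j))).
Qed.

Lemma nf_slift s : nf (slift s) = iota s.
Proof.
by rewrite /nf /heis_nf (gprodz_shift0 Afam) (gprodz_shift0 Bfam) !gmulr1.
Qed.

Lemma gprodz_dvec (C : 'I_18 -> 'I_18 -> G) p q : refl_family iota C ->
  gprodz (shift iota C ord0) (dvec p q) = shift iota C p q.
Proof.
move=> Cfam; have CC := shift_commute iotaM Cfam.
have hC := gprodz_hom (fun i j => CC ord0 i ord0 j).
rewrite (hC (delta_mx 0 q) (- delta_mx 0 p) : gprodz _ (_ - _) = _).
rewrite (ghomV hC (delta_mx 0 p) : gprodz _ (- _) = _) !gprodz_delta.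
by rewrite (shiftV iotaM Cfam) CC (shift_trans iotaM Cfam).
Qed.

Lemma nf_srefl10 p q : p != q -> nf (srefl p q 1 0) = A p q.
Proof.
move=> pq; rewrite /nf /heis_nf /= scale1r scale0r gprodz_dvec //.
by rewrite (gprodz_shift0 Bfam) !gmulr1 -refl_shift.
Qed.

Lemma nf_srefl01 p q : p != q -> nf (srefl p q 0 1) = B p q.
Proof.
move=> pq; rewrite /nf /heis_nf /= scale1r scale0r gprodz_dvec //.
by rewrite (gprodz_shift0 Afam) gmul1 gmulr1 -refl_shift.
Qed.

End WithCentre.

Lemma normal_form_exists : exists nf : SModel -> G,
  [/\ forall m m', balanced m -> balanced m' -> nf (m ** m') = nf m ** nf m',
      forall s, nf (slift s) = iota s,
      forall p q, p != q -> nf (srefl p q 1 0) = A p q &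
      forall p q, p != q -> nf (srefl p q 0 1) = B p q].
Proof.
have [Z [XYZ XZ YZ iZ]] := shifts_centre.
exists (nf Z); split=> [m m'|s|p q|p q]; [exact: nfM | exact: nf_slift | |].
- exact: nf_srefl10.
- exact: nf_srefl01.
Qed.

End NormalForm.

(** * Consequences of the relations of [C] *)

(* A Hamiltonian path: its edges generate a copy of the symmetric group by the
   Coxeter relations alone. *)
Definition hpath := [:: 3; 2; 7; 11; 12; 10; 18; 17; 9; 4; 6; 14; 16; 8; 5; 1; 13; 15].
Definition hedges := [:: 6; 1; 14; 21; 19; 20; 27; 18; 3; 9; 12; 25; 16; 11; 5; 2; 22].

Lemma hpath_inj : injective (fun i : 'I_18 => vtx (nth 0 hpath i)).
Proof.
move=> i j /eqP; have b (k : 'I_18) : 0 < nth 0 hpath k <= 18.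
  have /(all_nthP 0) h : all (fun v => 0 < v <= 18) hpath by [].
  exact: h.
by rewrite vtx_eq // nth_uniq // => /eqP /val_inj.
Qed.

Definition hperm : PermGroup := perm hpath_inj.

Lemma hperm_inord i : i < 18 -> hperm (inord i) = vtx (nth 0 hpath i).
Proof. by move=> i18; rewrite permE inordK. Qed.

Definition swapn (a b c : nat) := if c == a then b else if c == b then a else c.

Lemma tperm_vtx a b c : [&& 0 < a <= 18, 0 < b <= 18 & 0 < c <= 18] ->
  tperm (vtx a) (vtx b) (vtx c) = vtx (swapn a b c).
Proof.
case/and3P=> ha hb hc; rewrite /swapn; case: eqP => [->|/eqP ca]; first by rewrite tpermL.
case: eqP => [->|/eqP cb]; first by rewrite tpermR.
by rewrite tpermD // vtx_eq // eq_sym.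
Qed.

Section Relations.
Variables (G : agroup) (u : 'I_27 -> G).
Hypothesis uC : CRel u.
Notation U k := (u (edg k)).

Lemma Usq k : U k ** U k = gone.
Proof. by case: uC. Qed.

Lemma Ucommute a b : [&& 0 < a <= 27, 0 < b <= 27 & ~~ shareN a.-1 b.-1] -> gcommute (U a) (U b).
Proof.
by case: uC => _ cm _ _ /and3P[ha hb ns]; apply: cm; rewrite share_edg.
Qed.

Lemma Ubraid a b : [&& 0 < a <= 27, 0 < b <= 27, a != b & shareN a.-1 b.-1] ->
  U a ** U b ** U a = U b ** U a ** U b.
Proof.
case: uC => _ _ br _ /and4P[ha hb ab ns]; apply: br; rewrite ?share_edg //.
by rewrite -val_eqE /= !edg_val //; lia.
Qed.

Definition hex_ok (h : seq nat) : bool :=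
  let k i := nth 0 h i in
  [&& all (fun k => 0 < k <= 27) h, size h == 6, k 0 != k 1, shareN (k 0).-1 (k 1).-1 &
    [&& ~~ shareN (k 0).-1 (k 2).-1, ~~ shareN (k 0).-1 (k 3).-1 &
        ~~ shareN (k 0).-1 (k 4).-1]].

(** From [abcde = bcdef] one gets [cdef = babcde], so [cdefa = babcdea = (bab)a cde = abcde]: [a]
    commutes with [c], [d], [e] and braids with [b]. *)
Lemma hex_rel_rot h : hex_ok h -> hex_rel u h -> hex_rel u (rot 1 h).
Proof.
case/and5P; case: h => [|a [|b [|c [|d [|e [|f []]]]]]] // al _ ab sab /and3P[nc nd ne].
case/and5P: al => ha hb hc hd /and3P[he hf _].
rewrite /hex_rel /= => E.
have E' : U c ** U d ** U e ** U f = U b ** U a ** U b ** U c ** U d ** U e.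
  by apply: (@gmulI _ (U b)); rewrite !gmulA -E Usq gmul1.
rewrite E' -E.
have ca : gcommute (U c ** U d ** U e) (U a).
  by apply: gcommuteMl; [apply: gcommuteMl|]; apply/gcommuteC/Ucommute; rewrite ha ?hc ?hd ?he.
have -> : U b ** U a ** U b ** U c ** U d ** U e ** U a
        = U b ** U a ** U b ** (U c ** U d ** U e ** U a) by rewrite !gmulA.
rewrite ca !gmulA -(gmulA _ (U a) (U b)) -(gmulA _ _ (U a)).
have -> : U a ** U b ** U a = U b ** U a ** U b by apply: Ubraid; rewrite ha hb ab.
by rewrite !gmulA Usq gmul1.
Qed.

Lemma hex_rel_conj h : hex_rel u h -> let k i := nth 0 h i in
  U (k 5) = gconj (gconj (gconj (gconj (U (k 0)) (U (k 1))) (U (k 2))) (U (k 3))) (U (k 4)).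
Proof.
rewrite /hex_rel /= => E; rewrite -!gconjMr; apply/esym/gconj_eq.
by rewrite !gmulA.
Qed.

Lemma hexagon_rot n h : h \in hexagons -> n < 6 -> hex_rel u (rot n h).
Proof.
move=> hh n6; have ok : all (fun h => all (fun n => hex_ok (rot n h)) (iota 0 6)) hexagons.
  by vm_compute.
have {ok}ok m : m < 6 -> hex_ok (rot m h).
  by move=> m6; move/allP: ok => /(_ h hh) /allP; apply; rewrite mem_iota.
elim: n n6 => [|n IH] n6; first by case: uC => _ _ _; rewrite rot0; apply.
have sz : size h = 6 by have /and5P[_ /eqP] := ok 0 isT; rewrite size_rot.
rewrite rotS ?sz; last lia.
by apply: hex_rel_rot; [apply: ok; lia | apply: IH; lia].
Qed.

(** The sixth edge is this conjugate, further conjugated by three edges that commute with [U k];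
    those conjugations can be undone. *)
Lemma hex_commute h k : hex_rel u h -> let a i := nth 0 h i in
  gcommute (U k) (U (a 2)) -> gcommute (U k) (U (a 3)) -> gcommute (U k) (U (a 4)) ->
  gcommute (U k) (U (a 5)) -> gcommute (U k) (gconj (U (a 0)) (U (a 1))).
Proof.
move=> /hex_rel_conj /= -> c2 c3 c4.
have back (g b c : G) : gcommute g c -> gcommute g (gconj b c) -> gcommute g b.
  by move=> gc gb; apply: (@gconj_inj _ _ _ c); rewrite !gconjM (gconj_id gc).
by move=> /(back _ _ _ c4) /(back _ _ _ c3) /(back _ _ _ c2).
Qed.

Lemma hedges_coxeter : coxeter 17 (fun i => U (nth 0 hedges i)).
Proof.
have cm : all (fun i => all (fun j => (i.+1 < j) ==>
    [&& 0 < nth 0 hedges i <= 27, 0 < nth 0 hedges j <= 27 &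
        ~~ shareN (nth 0 hedges i).-1 (nth 0 hedges j).-1]) (iota 0 17)) (iota 0 17).
  by vm_compute.
have br : all (fun i => (i.+1 < 17) ==>
    [&& 0 < nth 0 hedges i <= 27, 0 < nth 0 hedges i.+1 <= 27,
        nth 0 hedges i != nth 0 hedges i.+1 &
        shareN (nth 0 hedges i).-1 (nth 0 hedges i.+1).-1]) (iota 0 17).
  by vm_compute.
split=> [i _|i j ij j17|i i17]; first exact: Usq.
  apply: Ucommute; have i17 : i \in iota 0 17 by rewrite mem_iota; lia.
  have {}j17 : j \in iota 0 17 by rewrite mem_iota; lia.
  by move/allP: cm => /(_ _ i17) /allP /(_ _ j17); rewrite ij.
apply: Ubraid; have i17' : i \in iota 0 17 by rewrite mem_iota; lia.
by move/allP: br => /(_ _ i17'); rewrite i17.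
Qed.

Lemma hpath_hom : exists2 io : PermGroup -> G, ghom io &
  forall k, k \in hedges ->
    U k = tau io (vtx (edge_of k).1) (vtx (edge_of k).2).
Proof.
have [f [fM fa]] := coxeter_hom hedges_coxeter.
(* [hperm] sends a position to the vertex there, so conjugating by its inverse turns the
   transposition of a path edge into some [adj i]. *)
pose io (s : PermGroup) := f (gconj s (ginv hperm)).
exists io => [s t|k kin]; first by rewrite /io gconjM fM.
have ed : all (fun i => (edge_of (nth 0 hedges i) == (nth 0 hpath i, nth 0 hpath i.+1))
     || (edge_of (nth 0 hedges i) == (nth 0 hpath i.+1, nth 0 hpath i))) (iota 0 17).
  by vm_compute.
have i17 : index k hedges < 17 by rewrite -index_mem in kin.
set i := index k hedges in i17.
have ek : nth 0 hedges i = k by rewrite nth_index.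
have key : tau io (vtx (nth 0 hpath i)) (vtx (nth 0 hpath i.+1)) = U k.
  rewrite /tau /io -!hperm_inord; try lia.
  rewrite -ek -fa //; congr f; rewrite permgroup_conj tpermJ.
  by rewrite !permK.
have /allP /(_ i) := ed; rewrite mem_iota ek => /(_ i17) /orP[] /eqP -> //=.
by rewrite tauC.
Qed.

End Relations.

(** * Expressing the generators through transpositions, [u_13] and [u_8] *)

Section Reconstruction.
Variables (G : agroup) (u : 'I_27 -> G).
Hypothesis uC : CRel u.
Notation U k := (u (edg k)).
Variable io : PermGroup -> G.
Hypothesis ioM : ghom io.
Hypothesis io_hedges : forall k, k \in hedges ->
  U k = tau io (vtx (edge_of k).1) (vtx (edge_of k).2).
Notation t a b := (tau io (vtx a) (vtx b)).

Lemma tau_commute_trans (w : G) a b c :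
  gcommute w (tau io a b) -> gcommute w (tau io b c) -> gcommute w (tau io a c).
Proof.
have [->//|ab] := eqVneq a b; have [->//|bc] := eqVneq b c.
have [->|ac] := eqVneq a c.
  move=> _ _; rewrite /tau tperm1 (ghom1 ioM : io 1%g = gone); exact: gcommute1.
move=> wab wbc; rewrite -(@tau_braid _ _ ioM a b c); last by rewrite /= !inE !negb_or ab ac bc.
by apply: gcommuteM => //; apply: gcommuteM.
Qed.

Lemma tree_commute (w : G) r es : grows [:: r] es ->
  (forall e, e \in es -> gcommute w (t e.1 e.2)) ->
  forall v v', v \in r :: map snd es -> v' \in r :: map snd es -> gcommute w (t v v').
Proof.
move=> gr we; have wr v : v \in r :: map snd es -> gcommute w (t r v).
  move=> vin; apply: (@grows_rel (fun a b => gcommute w (tau io a b)) (vtx r) [:: r] es) => //.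
  - by move=> a b c; apply: tau_commute_trans.
  - move=> v'; rewrite inE => /eqP ->.
    rewrite /tau tperm1 (ghom1 ioM : io 1%g = gone); exact: gcommute1.
  - by rewrite inE -in_cons.
move=> v v' /wr wv /wr wv'; apply: tau_commute_trans wv'.
by rewrite tauC.
Qed.

Lemma ord_of_vtx (a : 'I_18) s (r : seq nat) : all (fun v => (v \in s) || (v \in r)) (iota 1 18) ->
  a \notin map vtx s -> exists2 v, v \in r & a = vtx v.
Proof.
move=> /allP cov na; have a18 : (nat_of_ord a).+1 \in iota 1 18.
  by rewrite mem_iota; have := ltn_ord a; lia.
exists a.+1; last by rewrite vtxK.
have /orP[as_|//] := cov _ a18; case/negP: na; rewrite -[a]vtxK; exact: map_f.
Qed.

Lemma tau_tau a b c d : [&& 0 < a <= 18, 0 < b <= 18, 0 < c <= 18 & 0 < d <= 18] ->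
  gconj (t a b) (t c d) = t (swapn c d a) (swapn c d b).
Proof.
by case/and4P=> ha hb hc hd; rewrite tau_conj // !tperm_vtx ?ha ?hb ?hc ?hd.
Qed.

Lemma commute_edge w a b : 0 < w <= 27 ->
  has (fun k => ((edge_of k == (a, b)) || (edge_of k == (b, a))) && ~~ shareN w.-1 k.-1) hedges ->
  gcommute (U w) (t a b).
Proof.
move=> hw /hasP[k kin /andP[ek ns]].
have -> : t a b = U k by rewrite io_hedges //; case/orP: ek => /eqP -> //=; rewrite tauC.
have /allP hk : all (fun k => 0 < k <= 27) hedges by [].
by apply: (Ucommute uC); rewrite hw ns hk.
Qed.

Lemma edge_braid w k a b : k \in hedges ->
  [&& 0 < w <= 27, w != k, shareN w.-1 k.-1 & (edge_of k == (a, b)) || (edge_of k == (b, a))] ->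
  U w ** t a b ** U w = t a b ** U w ** t a b.
Proof.
move=> kin /and4P[hw wk sk ek].
have -> : t a b = U k by rewrite io_hedges //; case/orP: ek => /eqP -> //=; rewrite tauC.
have /allP hk : all (fun k => 0 < k <= 27) hedges by [].
by apply: (Ubraid uC); rewrite hw wk sk hk.
Qed.

(** Deleting [p] and [q] can cut the path in two; [e0] bridges the gap, and its commutation with
    [U w] has to come from elsewhere. *)
Lemma tree_commute_all w p q r es e0 : 0 < w <= 27 -> grows [:: r] es ->
  all (fun v => (v \in [:: p; q]) || (v \in r :: map snd es)) (iota 1 18) ->
  all (fun e => (e == e0) || has (fun k =>
    ((edge_of k == e) || (edge_of k == (e.2, e.1))) && ~~ shareN w.-1 k.-1) hedges) es ->
  gcommute (U w) (t e0.1 e0.2) ->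
  forall a b, a \notin [:: vtx p; vtx q] -> b \notin [:: vtx p; vtx q] ->
  gcommute (U w) (tau io a b).
Proof.
move=> hw gr cov /allP ok w0 a b na nb.
have [v vin ->] := @ord_of_vtx a [:: p; q] _ cov na.
have [v' v'in ->] := @ord_of_vtx b [:: p; q] _ cov nb.
apply: (tree_commute gr) vin v'in => e /ok /orP[/eqP-> //|he].
by apply: commute_edge => //; case: e he.
Qed.

(* The hexagon relations force the commutation of [u_13] with the transposition
   of its two neighbours on the path. *)
Lemma family13 : exists2 A, refl_family io A & A (vtx 7) (vtx 15) = U 13.
Proof.
have tri : gcommute (U 13) (t 2 11).
  have h : hex_rel u [:: 14; 1; 7; 9; 3; 17].
    by apply: (@hexagon_rot _ _ uC 5 [:: 1; 7; 9; 3; 17; 14]).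
  have := hex_commute h (k := 13); rewrite /= (io_hedges (k := 14)) // (io_hedges (k := 1)) //.
  by rewrite tau_tau // tauC; apply; apply: (Ucommute uC).
(* The path edges 22, from 15 to 13, and 1, from 7 to 2, provide the braid relations at the two
   ends. *)
apply: (@refl_family_exists _ _ ioM _ _ _ (vtx 13) (vtx 2)).
- by rewrite /= !inE !negb_or !vtx_neq.
- by rewrite /= !inE !negb_or !vtx_neq.
- exact: Usq.
- by apply: (@tree_commute_all 13 7 15 3 [:: (3, 2); (2, 11); (11, 12); (12, 10); (10, 18);
    (18, 17); (17, 9); (9, 4); (4, 6); (6, 14); (14, 16); (16, 8); (8, 5); (5, 1); (1, 13)]
    (2, 11)).
- by apply: (@edge_braid 13 22).
- by apply: (@edge_braid 13 1).
Qed.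

(** As for edge 13: vertex 3 starts the path, and the gap left by 10 lies between 12 and 18. Edge 20
    conjugated by edge 19 is the transposition across it. *)
Lemma family8 : exists2 B, refl_family io B & B (vtx 3) (vtx 10) = U 8.
Proof.
have tri : gcommute (U 8) (t 12 18).
  have h : hex_rel u [:: 20; 19; 21; 17; 18; 27].
    by apply: (@hexagon_rot _ _ uC 4 [:: 21; 17; 18; 27; 20; 19]).
  have := hex_commute h (k := 8); rewrite /= (io_hedges (k := 20)) // (io_hedges (k := 19)) //.
  by rewrite tau_tau //; apply; apply: (Ucommute uC).
apply: (@refl_family_exists _ _ ioM _ _ _ (vtx 12) (vtx 2)).
- by rewrite /= !inE !negb_or !vtx_neq.
- by rewrite /= !inE !negb_or !vtx_neq.
- exact: Usq.
- by apply: (@tree_commute_all 8 3 10 2 [:: (2, 7); (7, 11); (11, 12); (12, 18);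
    (18, 17); (17, 9); (9, 4); (4, 6); (6, 14); (14, 16); (16, 8); (8, 5); (5, 1); (1, 13); (13, 15)]
    (12, 18)).
- by apply: (@edge_braid 8 19).
- by apply: (@edge_braid 8 6).
Qed.

Section WithFamilies.
Variables A B : 'I_18 -> 'I_18 -> G.
Hypothesis Afam : refl_family io A.
Hypothesis Bfam : refl_family io B.
Hypothesis A13 : A (vtx 7) (vtx 15) = U 13.
Hypothesis B8 : B (vtx 3) (vtx 10) = U 8.

Lemma fam_tau (C : 'I_18 -> 'I_18 -> G) a b c d : refl_family io C ->
  [&& 0 < a <= 18, 0 < b <= 18, 0 < c <= 18, 0 < d <= 18 & a != b] ->
  gconj (C (vtx a) (vtx b)) (t c d) = C (vtx (swapn c d a)) (vtx (swapn c d b)).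
Proof.
case=> eqv _ _ _ /and5P[ha hb hc hd ab].
by rewrite eqv ?vtx_eq // !tperm_vtx ?ha ?hb ?hc ?hd.
Qed.

Definition uniq_vtx (s : seq nat) := all (fun v => 0 < v <= 18) s && uniq s.

Lemma uniq_vtxP s : uniq_vtx s -> uniq (map vtx s).
Proof.
case/andP=> bs us; rewrite map_inj_in_uniq // => x y /(allP bs) bx /(allP bs) by' /eqP.
by rewrite vtx_eq // => /eqP.
Qed.

Lemma tau_famR (C : 'I_18 -> 'I_18 -> G) p q r : refl_family io C -> uniq_vtx [:: p; q; r] ->
  gconj (t q r) (C (vtx p) (vtx q)) = C (vtx p) (vtx r).
Proof. by case=> _ _ h _ /uniq_vtxP; apply: h. Qed.

Lemma tau_famL (C : 'I_18 -> 'I_18 -> G) p q r : refl_family io C -> uniq_vtx [:: p; q; r] ->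
  gconj (t p r) (C (vtx p) (vtx q)) = C (vtx r) (vtx q).
Proof. by case=> _ _ _ h /uniq_vtxP; apply: h. Qed.

Let hex n h : h \in hexagons -> n < 6 -> hex_rel u (rot n h) := @hexagon_rot _ _ uC n h.

(** Here and below the rotation puts the wanted edge sixth, after five known ones. Edges 10 and 17
    need only the path; 7 needs 17, 23 needs 10, 4 needs 13, 24 needs 7 and 8, and 26 needs 23 and
    24. *)
Lemma U10 : U 10 = t 4 5.
Proof.
have /hex_rel_conj /= -> := @hex 5 [:: 12;25;16;11;10;9] isT isT.
by rewrite !io_hedges // !tau_tau.
Qed.

Lemma U17 : U 17 = t 9 11.
Proof.
have /hex_rel_conj /= -> := @hex 2 [:: 21;17;18;27;20;19] isT isT.
by rewrite !io_hedges // !tau_tau.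
Qed.

Lemma U7 : U 7 = t 2 6.
Proof.
have /hex_rel_conj /= -> := @hex 2 [:: 1;7;9;3;17;14] isT isT.
by rewrite U17 !io_hedges // !tau_tau // tauC.
Qed.

Lemma U23 : U 23 = t 13 17.
Proof.
have /hex_rel_conj /= -> := @hex 5 [:: 3;10;5;2;23;18] isT isT.
by rewrite U10 !io_hedges // !tau_tau // tauC.
Qed.

Lemma U4 : U 4 = A (vtx 3) (vtx 1).
Proof.
have /hex_rel_conj /= -> := @hex 2 [:: 2;4;6;1;13;22] isT isT.
by rewrite -A13 !io_hedges // !tau_tau //= tau_famL // !fam_tau.
Qed.

Lemma U24 : U 24 = B (vtx 14) (vtx 18).
Proof.
have /hex_rel_conj /= -> := @hex 3 [:: 8;20;24;12;7;6] isT isT.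
by rewrite U7 -B8 !io_hedges // !tau_tau //= tau_famL // !fam_tau.
Qed.

Lemma U26 : U 26 = B (vtx 16) (vtx 15).
Proof.
have /hex_rel_conj /= -> := @hex 4 [:: 27;23;22;26;25;24] isT isT.
by rewrite U24 U23 !io_hedges // tau_famL // !fam_tau.
Qed.

(** The two hexagons through edge 15 lead from vertex 8 to 12 in different ways: via 3 here, via 15
    in [U15']. *)
Lemma U15 : U 15 = gconj (B (vtx 3) (vtx 12)) (A (vtx 3) (vtx 8)).
Proof.
have /hex_rel_conj /= -> := @hex 2 [:: 11;15;19;8;4;5] isT isT.
rewrite U4 -B8 !io_hedges // tau_famR //.
by do 2!rewrite [gconj (gconj _ (A _ _)) _]gconj_gconj !fam_tau //=.
Qed.

Lemma U15' : U 15 = gconj (B (vtx 8) (vtx 15)) (A (vtx 12) (vtx 15)).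
Proof.
have /hex_rel_conj /= -> := @hex 5 [:: 26;13;14;21;15;16] isT isT.
rewrite U26 -A13 !io_hedges // tauC tau_famL //.
by do 2!rewrite [gconj (gconj _ (A _ _)) _]gconj_gconj !fam_tau //=.
Qed.

Lemma AB_commute p q r s : uniq [:: p; q; r; s] -> gcommute (A p q) (B r s).
Proof.
move=> us; have u0 : uniq (map vtx [:: 7; 15; 3; 10]) by apply: uniq_vtxP.
have [f [<- <- <- <-]] := perm_map_exists u0 us erefl.
case: Afam Bfam => [Ae _ _ _] [Be _ _ _]; rewrite -Ae ?vtx_neq // -Be ?vtx_neq //.
by apply: gcommute_conj; rewrite A13 B8; apply: (Ucommute uC).
Qed.

(** The two values of [u_15], at the quadruple 3, 8, 12, 15, are carried to every quadruple by a
    permutation. *)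
Lemma AB_conj p q r s : uniq [:: p; q; r; s] ->
  gconj (B p r) (A p q) = gconj (B q s) (A r s).
Proof.
move=> us; have u0 : uniq (map vtx [:: 3; 8; 12; 15]) by apply: uniq_vtxP.
have [f [<- <- <- <-]] := perm_map_exists u0 us erefl.
case: Afam Bfam => [Ae _ _ _] [Be _ _ _]; rewrite -!Ae ?vtx_neq // -!Be ?vtx_neq //.
by rewrite -!gconj_gconj -U15 -U15'.
Qed.

End WithFamilies.
End Reconstruction.

Lemma srefl00 p q : srefl p q 0%R 0%R = slift (tperm p q).
Proof. by rewrite /srefl !scale0r mul0r oppr0. Qed.

Lemma model_retraction (G : agroup) (u : 'I_27 -> G) : CRel u ->
  exists nf : SModel -> G,
    (forall m m', balanced m -> balanced m' -> nf (m ** m') = nf m ** nf m') /\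
    (forall j, nf (sgen j) = u j).
Proof.
move=> uC; have [io ioM ioh] := hpath_hom uC.
have [A Af A13] := family13 uC ioM ioh; have [B Bf B8] := family8 uC ioM ioh.
have [nf [nfM nfs nfA nfB]] := normal_form_exists ioM Af Bf
  (AB_commute uC Af Bf A13 B8) (AB_conj uC ioM ioh Af Bf A13 B8).
exists nf; split=> // j.
have nft k : (0 < k <= 27) -> nth (0%R, 0%R) volts k.-1 = (0%R, 0%R) ->
    u (edg k) = tau io (vtx (edge_of k).1) (vtx (edge_of k).2) -> nf (sgen (edg k)) = u (edg k).
  move=> hk ek ->; rewrite (@sgen_orient k (edge_of k).1 (edge_of k).2); last first.
    by rewrite hk -surjective_pairing eqxx.
  by rewrite /ovolt -surjective_pairing eqxx ek srefl00 nfs.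
have -> : j = edg j.+1 by rewrite /edg /= inord_val.
have : j.+1 \in iota 1 27 by rewrite mem_iota; have := ltn_ord j; lia.
move: (j.+1) => k {j}.
have /allP cov : all [in hedges ++ [:: 10; 17; 7; 23; 4; 8; 13; 15; 24; 26]] (iota 1 27) by [].
move/cov; rewrite mem_cat => /orP[kin|].
  have /allP ok : all (fun k => (0 < k <= 27) && (nth (0%R, 0%R) volts k.-1 == (0%R, 0%R))) hedges.
    by vm_compute.
  by have /andP[hk /eqP ek] := ok _ kin; apply: nft => //; apply: ioh.
rewrite !inE => /or4P[/eqP->|/eqP->|/eqP->|].
- by apply: nft => //; apply: (U10 uC ioM ioh).
- by apply: nft => //; apply: (U17 uC ioM ioh).
- by apply: nft => //; apply: (U7 uC ioM ioh).
case/or4P=> [/eqP->|/eqP->|/eqP->|].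
- by apply: nft => //; apply: (U23 uC ioM ioh).
- rewrite (@sgen_orient 4 3 1) // (U4 uC ioM ioh Af A13) -nfA //.
  exact: vtx_neq.
- by rewrite (@sgen_orient 8 3 10) // -B8 -nfB // vtx_neq.
case/or4P=> [/eqP->|/eqP->|/eqP->|/eqP->].
- by rewrite (@sgen_orient 13 7 15) // -A13 -nfA // vtx_neq.
- rewrite (@sgen_orient 15 8 12) // (U15 uC ioM ioh Af Bf A13 B8).
  have n83 : vtx 8 != vtx 3 by apply: vtx_neq.
  have n312 : vtx 3 != vtx 12 by apply: vtx_neq.
  have n812 : vtx 8 != vtx 12 by apply: vtx_neq.
  (* The displacement (-1, 1) of edge 15 is composed as in [U15]: (-1, 0) from 8 to 3, then (0, 1)
     from 3 to 12. *)
  have e := srefl_braid (-1)%R 0%R 0%R 1%R n83 n312 n812.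
  have -> : srefl (vtx 8) (vtx 12) (ovolt 15 8 12).1 (ovolt 15 8 12).2 =
     srefl (vtx 8) (vtx 12) (-1 + 0)%R (0 + 1)%R by [].
  rewrite -e (sreflC (vtx 8) (vtx 3)) opprK oppr0.
  rewrite !nfM; try by do ?apply: balancedM; apply: balanced_srefl.
  rewrite nfA 1?eq_sym // nfB // /gconj.
  by case: Af => _ sq _ _; rewrite (ginv_eq (sq _ _ _)) // eq_sym.
- by rewrite (@sgen_orient 24 14 18) // (U24 uC ioM ioh Bf B8) -nfB // vtx_neq.
- by rewrite (@sgen_orient 26 16 15) // (U26 uC ioM ioh Bf B8) -nfB // vtx_neq.
Qed.

(** * Homomorphisms out of [C] and [H] *)

Lemma CRel_hom (G K : agroup) (u : 'I_27 -> G) (f : G -> K) :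
  ghom f -> CRel u -> CRel (fun j => f (u j)).
Proof.
move=> fM [sq cm br hx]; split=> [j|i j ns|i j ij sh|h hin].
- by rewrite -fM sq ghom1.
- by rewrite -!fM cm.
- by rewrite -!fM br.
- by rewrite /hex_rel -!fM hx.
Qed.

Lemma presentsC_ext (C : agroup) (u : 'I_27 -> C) (K : agroup) (f g : C -> K) :
  presentsC u -> ghom f -> ghom g -> (forall j, f (u j) = g (u j)) -> forall c, f c = g c.
Proof.
move=> [uC uni] fM gM fg c.
have [h [_ hu]] := uni K _ (CRel_hom fM uC).
have e1 : h = f by apply: hu; split.
have e2 : h = g by apply: hu; split.
by rewrite -e1 e2.
Qed.

(** [HRel] requires [z'] to be central in all of [K], not only in the image of [f], hence the
    hypothesis on [f z]. *)
Lemma presentsH_ext (H : agroup) (x y : 'I_18 -> H) (z : H) (K : agroup) (f g : H -> K) :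
  presentsH x y z -> ghom f -> ghom g -> central (f z) ->
  (forall i, f (x i) = g (x i)) -> (forall i, f (y i) = g (y i)) -> f z = g z ->
  forall h, f h = g h.
Proof.
move=> [[c1 c2 zc] uni] fM gM fz fx fy ez h.
have [] := uni K (fun i => f (x i)) (fun i => f (y i)) (f z).
  split=> // [i j ij|i]; last by rewrite -(ghom_gcomm fM) c2.
  by have [e1 e2 e3] := c1 _ _ ij; split; rewrite -(ghom_gcomm fM) ?e1 ?e2 ?e3 ghom1.
move=> k [_ ku]; have e1 : k = f by apply: ku; split.
have e2 : k = g by apply: ku; split.
by rewrite -e1 e2.
Qed.

(** * Generation and centre of the balanced subgroup *)

Section Main.
Local Open Scope ring_scope.

Lemma sheis_central c : central (sheis 0 0 c).
Proof.
move=> m; rewrite !smodel_mul; apply: smod_eq; rewrite /= ?mul1g ?mulg1 // ?perm_mx1 ?mulmx1.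
- by rewrite mul0mx addr0 add0r.
- by rewrite mul0mx addr0 add0r.
- by rewrite mul0mx dot0l dot0r !subr0 addrC.
Qed.

Lemma sheis_gpow c n : gpow (sheis 0 0 c) n = sheis 0 0 (c *~ n).
Proof.
have hz : @ghom (ZmodGroup int) SModel (fun c => sheis 0 0 c).
  by move=> v w; rewrite sheisM dot0l !addr0.
by rewrite (ghom_scale hz).
Qed.

Lemma srefl_conj p q m n s : gconj (srefl p q m n) (slift s) = srefl (s p) (s q) m n.
Proof.
have e p' q' : srefl p' q' m n = slift (tperm p' q')
    ** sheis (m *: dvec p' q') (n *: dvec p' q') (- (m * n)) by rewrite slift_sheis.
rewrite !e gconjM sheis_conj -!scalemxAl !dvec_perm; congr (_ ** _).
by rewrite -(ghom_gconj slift_hom) permgroup_conj tpermJ.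
Qed.

Lemma tperm_gen (P : PermGroup -> Prop) : P gone ->
  (forall s t, P s -> P t -> P (s ** t)) -> (forall p q, P (tperm p q)) -> forall s, P s.
Proof.
move=> P1 PM Pt s; apply: (@perm_fix_ind _ set0 P) => //.
  by move=> s' p q Ps _ _; apply: PM.
by move=> p; rewrite inE.
Qed.

Lemma tperm_rel_trans (P : PermGroup -> Prop) : P gone ->
  (forall s t, P s -> P t -> P (s ** t)) ->
  forall a b c, P (tperm a b) -> P (tperm b c) -> P (tperm a c).
Proof.
move=> P1 PM a b c; have [->//|ab] := eqVneq a b; have [->//|bc] := eqVneq b c.
have [->|ac] := eqVneq a c; first by rewrite tperm1.
by move=> Pab Pbc; rewrite -(tperm_braid ab bc ac); apply: (PM _ _ (PM _ _ Pab Pbc) Pab).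
Qed.

(** Path edges have displacement zero and generate all lifted permutations; these conjugate the
    reflections of edges 13 and 8 to all those needed by [balanced_ind]. *)
Lemma sgen_generate (P : SModel -> Prop) : P gone ->
  (forall m m', P m -> P m' -> P (m ** m')) -> (forall m, P m -> P (ginv m)) ->
  (forall j, P (sgen j)) -> forall m, balanced m -> P m.
Proof.
move=> P1 PM PV Pg.
have Ps s : P (slift s).
  move: s; apply: tperm_gen => [|s t Ps Pt|].
  - by rewrite (ghom1 slift_hom).
  - by rewrite slift_hom; apply: PM.
  pose Q a b := P (slift (tperm a b)).
  have Qt a b c : Q a b -> Q b c -> Q a c.
    apply: (@tperm_rel_trans (fun s => P (slift s))) => [|s t Ps Pt].
      by rewrite (ghom1 slift_hom).
    by rewrite slift_hom; apply: PM.
  have Qs a b : Q a b -> Q b a by rewrite /Q tpermC.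
  have Qr a : Q a a by rewrite /Q tperm1 (ghom1 slift_hom : slift 1%g = gone).
  pose es := [:: (3, 2); (2, 7); (7, 11); (11, 12); (12, 10); (10, 18); (18, 17); (17, 9);
    (9, 4); (4, 6); (6, 14); (14, 16); (16, 8); (8, 5); (5, 1); (1, 13); (13, 15)]%N.
  have Qe e : e \in es -> Q (vtx e.1) (vtx e.2).
    have /allP h : all (fun e => has (fun k => [&& (0 < k <= 27)%N,
       (edge_of k == e) || (edge_of k == (e.2, e.1)) & nth (0, 0) volts k.-1 == (0, 0)]) hedges) es.
      by vm_compute.
    case/h/hasP=> k _ /and3P[hk ek /eqP vk]; case: e ek => a b /= ek.
    have := Pg (edg k); rewrite (@sgen_orient k a b) ?hk //.
    by rewrite /ovolt vk oppr0; case: ifP; rewrite srefl00.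
  have Q3 v : Q (vtx 3) v.
    have : all (fun v => (v \in [:: 3]) || (v \in map snd es))%N (iota 1 18) by [].
    have vi : (nat_of_ord v).+1 \in iota 1 18 by rewrite mem_iota; have := ltn_ord v; lia.
    move=> /allP /(_ _ vi) vin.
    rewrite -(vtxK v); apply: (@grows_rel Q _ [:: 3%N] es) => //.
    by move=> w; rewrite inE => /eqP ->.
  by move=> p q; apply: Qt (Q3 q); apply/Qs/Q3.
have Pr p0 q0 m n p q : p0 != q0 -> p != q -> P (srefl p0 q0 m n) -> P (srefl p q m n).
  move=> pq0 pq Pm; have [f [<- <-]] : exists f : {perm 'I_18}, map f [:: p0; q0] = [:: p; q].
    by apply: perm_map_exists; rewrite //= inE ?pq0 ?pq.
  by rewrite -srefl_conj /gconj; apply: (PM _ _ (PM _ _ (PV _ (Ps f)) Pm) (Ps f)).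
apply: balanced_ind => // p q pq.
  apply: (Pr (vtx 7) (vtx 15)); rewrite ?vtx_neq //.
  by have := Pg (edg 13); rewrite (@sgen_orient 13 7 15).
apply: (Pr (vtx 3) (vtx 10)); rewrite ?vtx_neq //.
by have := Pg (edg 8); rewrite (@sgen_orient 8 3 10).
Qed.

(** Commuting with [S_18] kills the permutation part and makes both vectors constant; a constant
    vector of sum zero vanishes, as 18 is nonzero in the integers. *)
Lemma smodel_central (m : SModel) : balanced m -> (forall s, gcommute m (slift s)) ->
  exists n, m = sheis 0 0 n.
Proof.
case: m => s a b c [/= za zb] cm.
have inv_tperm (v : 'rV[int]_18) : zsum v -> (forall p q, v *m perm_mx (tperm p q) = v) -> v = 0.
  move=> zv vt; have vc i : v 0 i = v 0 ord0.
    have [->//|i0] := eqVneq i ord0.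
    have /rowP /(_ i) := vt ord0 i; rewrite tperm_row !mxE !eqxx (negPf i0) /=.
    by move=> e; apply/eqP; rewrite -subr_eq0; apply/eqP; lia.
  have /rowP /(_ 0) := zv; rewrite !mxE => s0.
  have {s0} v0 : v 0 ord0 = 0.
    move: s0; under eq_bigr => i _ do rewrite vc mxE mulr1.
    by rewrite sumr_const card_ord => /eqP; rewrite -mulr_natr mulf_eq0 orbF => /eqP.
  by apply/rowP => i; rewrite vc v0 mxE.
have s1 : s = 1%g.
  apply/permP => i; rewrite perm1; apply/eqP/negPn/negP => si.
  have [k] := @fresh_ord [:: i; s i] isT; rewrite !inE negb_or => /andP[ki ks].
  have /(congr1 sperm) /= := cm (tperm (s i) k).
  move/(congr1 (fun t : {perm 'I_18} => t i)); rewrite !permM tpermL.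
  by rewrite tpermD // => e; rewrite e eqxx in ks.
exists c; rewrite s1 in cm *; congr Smod; apply: inv_tperm => // p q.
  by have /(congr1 sx) /= := cm (tperm p q); rewrite mul0mx addr0 add0r.
by have /(congr1 sy) /= := cm (tperm p q); rewrite mul0mx addr0 add0r.
Qed.

(** Coordinates on the sum-zero lattice: the other 17 entries are free and determine the one at
    [ord0]. *)
Definition tl (a : 'rV[int]_18) : 'rV[int]_17 := \row_j a 0 (lift ord0 j).

Lemma tlD a b : tl (a + b) = tl a + tl b.
Proof. by apply/rowP => j; rewrite !mxE. Qed.

Lemma tl0 : tl 0 = 0.
Proof. by apply/rowP => j; rewrite !mxE. Qed.

Lemma tl_eq0 a : zsum a -> tl a = 0 -> a = 0.
Proof.
move=> za /rowP ta; rewrite (zsum_decomp za) big1 // => i _.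
have [->|i0] := eqVneq i ord0; first by rewrite /dvec subrr scaler0.
have [j ->|] := unliftP ord0 i; last by move/eqP; rewrite (negPf i0).
by have := ta j; rewrite !mxE => ->; rewrite scale0r.
Qed.

Lemma tl_surj (w : 'rV[int]_17) : exists2 a, zsum a & tl a = w.
Proof.
exists (\sum_j w 0 j *: dvec ord0 (lift ord0 j)).
  by elim/big_ind: _ => [|a b|j _]; [exact: zsum0 | exact: zsumD | exact/zsumZ/zsum_dvec].
have l0 j : (lift ord0 j == ord0 :> 'I_18) = false by rewrite eq_sym (negPf (neq_lift _ _)).
apply/rowP => k; rewrite mxE summxE (bigD1 k) //= big1 => [|j jk]; rewrite !mxE l0 !eqxx.
  by rewrite ?subr0 ?mulr1 ?addr0.
by rewrite (inj_eq lift_inj) eq_sym (negPf jk) subr0 mulr0.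
Qed.

(** * Identification of [H] with the Heisenberg part of the model *)

Lemma heis_model (H : agroup) (x y : 'I_18 -> H) (z : H) : presentsH x y z ->
  exists F : H -> SModel, exists N : SModel -> H,
    [/\ ghom F, (forall h, sperm (F h) = 1%g), (forall h, N (F h) = h),
        (forall m, F (N m) = sheis (sx m) (sy m) (sz m)) &
        [/\ forall i, F (x i) = sheis (delta_mx 0 i) 0 0,
            forall i, F (y i) = sheis 0 (delta_mx 0 i) 0 & F z = sheis 0 0 1]].
Proof.
move=> HH; have [[c1 c2 zc] uni] := HH.
have rel : HRel (fun i => sheis (delta_mx 0 i) 0 0) (fun i => sheis 0 (delta_mx 0 i) 0) (sheis 0 0 1).
  split=> [i j ij|i|]; last exact: sheis_central.
    split; apply: gcomm_eq.
    - by rewrite gmulr1 !sheisM !dot0r addrC.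
    - by rewrite gmulr1 !sheisM !dot0l (addrC (delta_mx 0 i)).
    - rewrite gmulr1 !sheisM dot0l dot_delta mxE eqxx eq_sym (negPf ij).
      by rewrite !addr0 !add0r.
  by apply: gcomm_eq; rewrite !sheisM !dot0l dot_delta mxE !eqxx !addr0 !add0r.
have [F [[FM Fx Fy Fz] _]] := uni _ _ _ _ rel.
have F1 h : sperm (F h) = 1%g.
  apply: (@presentsH_ext _ _ _ _ PermGroup (fun h => sperm (F h)) (fun=> 1%g) HH).
  - by move=> a b; rewrite FM.
  - by move=> a b; rewrite /gmul /= mulg1.
  - by rewrite Fz => b; rewrite /gmul /= mul1g mulg1.
  - by move=> i; rewrite Fx.
  - by move=> i; rewrite Fy.
  - by rewrite Fz.
have xx i j : gcommute (x i) (x j).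
  by have [->//|ij] := eqVneq i j; have [/gcomm_eq1] := c1 _ _ ij.
have yy i j : gcommute (y i) (y j).
  by have [->//|ij] := eqVneq i j; have [_ /gcomm_eq1] := c1 _ _ ij.
have xy i j : x i ** y j = y j ** x i ** gpow z ((1%:M : 'M[int]_18) i j).
  rewrite mxE; have [->|ij] := eqVneq i j; first by rewrite gpow1 gcommP c2.
  by rewrite gmulr1; have [_ _ /gcomm_eq1] := c1 _ _ ij.
pose N (m : SModel) := heis_nf x y z (sx m) (sy m) (sz m).
have form a b : heis_form 1%:M a b = dot a b by rewrite /heis_form mulmx1.
exists F, N; split=> // [h|m].
  apply: (@presentsH_ext _ _ _ _ _ (fun h => N (F h)) id HH) => //.
  - move=> a b; rewrite FM /N (heis_nfM xx yy _ _ xy) ?form => [|i|i]; try exact: zc.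
    by rewrite smodel_mul /= !F1 !perm_mx1 !mulmx1.
  - rewrite /= Fz /N /heis_nf /=.
    rewrite (ghom1 (gprodz_hom xx) : gprodz x 0 = gone).
    by rewrite (ghom1 (gprodz_hom yy) : gprodz y 0 = gone) !gmul1.
  - move=> i; rewrite Fx /N /heis_nf gprodz_delta.
    by rewrite (ghom1 (gprodz_hom yy) : gprodz y 0 = gone) !gmulr1.
  - move=> i; rewrite Fy /N /heis_nf gprodz_delta.
    by rewrite (ghom1 (gprodz_hom xx) : gprodz x 0 = gone) gmul1 gmulr1.
  - rewrite Fz /N /heis_nf (ghom1 (gprodz_hom xx) : gprodz x 0 = gone).
    by rewrite (ghom1 (gprodz_hom yy) : gprodz y 0 = gone) !gmul1; apply: gpow1.
have Fpx (a : 'rV_18) : F (gprodz x a) = sheis a 0 0.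
  move: a; apply: ghom_rV_ext => [v w|v w|i].
  - by rewrite (gprodz_hom xx) FM.
  - by rewrite sheisM dot0r !addr0.
  - by rewrite gprodz_delta.
have Fpy (a : 'rV_18) : F (gprodz y a) = sheis 0 a 0.
  move: a; apply: ghom_rV_ext => [v w|v w|i].
  - by rewrite (gprodz_hom yy) FM.
  - by rewrite sheisM dot0l !addr0.
  - by rewrite gprodz_delta.
rewrite /N /heis_nf !FM Fpx Fpy ghom_gpow // Fz sheis_gpow intz !sheisM !dot0l.
by rewrite !oppr0 !addr0 !add0r.
Qed.

Lemma model_iso (C : agroup) (u : 'I_27 -> C) : presentsC u ->
  exists f : C -> SModel,
    [/\ ghom f, forall j, f (u j) = sgen j, injective f, forall c, balanced (f c) &
        forall m, balanced m -> exists c, f c = m].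
Proof.
move=> HC; have [uC uni] := HC.
have [f [[fM fu] _]] := uni _ _ sgen_CRel.
(* The coordinate sum is permutation invariant, hence a homomorphism from C to an abelian group; it
   vanishes on the generators. *)
have zs (p : SModel -> 'rV[int]_18) :
    (forall m m' : SModel, p (m ** m') = p m *m perm_mx (sperm m') + p m') ->
    (forall j, zsum (p (sgen j))) -> forall c, zsum (p (f c)).
  move=> pM pg; apply: (@presentsC_ext _ _ (ZmodGroup 'M[int]_1)
    (fun c => p (f c) *m (const_mx 1 : 'cV_18)) (fun=> 0) HC).
  - by move=> a b; rewrite fM pM mulmxDl -mulmxA perm_const.
  - by move=> a b; rewrite /gmul /= addr0.
  - by move=> j; rewrite fu; apply: pg.
have fb c : balanced (f c).
  by split; apply: zs => // j; apply/zsumZ/zsum_dvec.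
have [nf [nfM nfu]] := model_retraction uC.
have nfK c : nf (f c) = c.
  apply: (@presentsC_ext _ _ _ (fun c => nf (f c)) id HC) => // [a b|j].
    by rewrite fM nfM.
  by rewrite fu nfu.
exists f; split=> //; first exact: can_inj nfK.
apply: sgen_generate => [|m m' [c <-] [d <-]|m [c <-]|j].
- by exists gone; rewrite ghom1.
- by exists (c ** d); rewrite fM.
- by exists (ginv c); rewrite ghomV.
- by exists (u j).
Qed.

End Main.

Theorem theorem1p1
  (C : agroup) (u : 'I_27 -> C) (HC : presentsC u)
  (psi : C -> PermGroup) (psi_hom : ghom psi)
  (psi_u : forall j, psi (u j) = tperm (ep1 j) (ep2 j))
  (H : agroup) (x y : 'I_18 -> H) (z : H) (HH : presentsH x y z)
  (ab : H -> Z2) (ab_hom : ghom ab)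
  (ab_x : forall i, ab (x i) = xZ) (ab_y : forall i, ab (y i) = yZ)
  (ab_z : ab z = 0%R)
  (act : {perm 'I_18} -> H -> H) (act_hom : forall s, ghom (act s))
  (act_x : forall s i, act s (x i) = x (s i))
  (act_y : forall s i, act s (y i) = y (s i))
  (act_z : forall s, act s z = z) :
  (* (i) *)
  ((forall s : PermGroup, exists c, psi c = s) /\
   (let L := gen_sub (fun c : C => exists2 j, j \in T0 & c = u j) in
    [/\ (forall a b, L a -> L b -> psi a = psi b -> a = b),
        (forall s : PermGroup, exists a, L a /\ psi a = s) &
        (forall c : C, exists! kl : C * C,
            [/\ gker psi kl.1, L kl.2 & c = kl.1 ** kl.2])])) /\
  (* (ii) *)
  (exists f : C -> H, iso_on f (gker psi) (gker ab)) /\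
  (exists phi : C -> H,
     [/\ (forall c, ab (phi c) = 0%R),
         (forall c d, phi (c ** d) = act (psi d) (phi c) ** phi d),
         (forall (s : PermGroup) (k : H), ab k = 0%R ->
             exists! c, psi c = s /\ phi c = k) &
  (* (iii) *)
         (exists zC : C,
            [/\ psi zC = gone, phi zC = z,
                (forall n, gpow zC n = gone -> n = 0%R),
                (forall c, central c <-> exists n, c = gpow zC n) &
                (exists q : C -> Z34,
                   [/\ (forall a b, gker psi a -> gker psi b -> q (a ** b) = q a ** q b),
                       (forall v : Z34, exists2 a, gker psi a & q a = v) &
                       (forall a, gker psi a -> (q a = gone <-> exists n, a = gpow zC n))])])]).
Proof.
have [f [fM fu finj fb fsurj]] := model_iso HC.
have [F [N [FM F1 FK NK [Fx Fy Fz]]]] := heis_model HH.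
have fpsi c : sperm (f c) = psi c.
  apply: (@presentsC_ext _ _ PermGroup (fun c => sperm (f c)) psi HC) => // [a b|j].
    by rewrite fM.
  by rewrite fu psi_u.
have Finj : injective F := can_inj FK.
have FE h : F h = sheis (sx (F h)) (sy (F h)) (sz (F h)).
  by apply: smod_eq.
(* The Heisenberg part of [f c]: a crossed homomorphism, which becomes an honest one on the kernel
   of [psi]. *)
pose phi c := N (f c).
have Fphi c : F (phi c) = sheis (sx (f c)) (sy (f c)) (sz (f c)) by exact: NK.
have Fact s h : F (act s h) = gconj (F h) (slift s).
  apply: (@presentsH_ext _ _ _ _ _ (fun h => F (act s h)) (fun h => gconj (F h) (slift s)) HH).
  - by move=> a b; rewrite act_hom FM.
  - by move=> a b; rewrite FM gconjM.
  - by rewrite act_z Fz; apply: sheis_central.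
  - by move=> i; rewrite act_x !Fx sheis_conj delta_perm mul0mx.
  - by move=> i; rewrite act_y !Fy sheis_conj delta_perm mul0mx.
  - by rewrite act_z Fz sheis_conj !mul0mx.
have abE h : ab h = (((sx (F h)) *m (const_mx 1 : 'cV_18)) 0 0 *: xZ
                     + ((sy (F h)) *m (const_mx 1 : 'cV_18)) 0 0 *: yZ)%R.
  move: h; apply: (presentsH_ext HH ab_hom).
  - move=> a b; rewrite FM smodel_mul /= F1 perm_mx1 !mulmx1 !mulmxDl !mxE !scalerDl.
    by rewrite /gmul /= addrACA.
  - by move=> b; rewrite /gmul /= addrC.
  - by move=> i; rewrite ab_x Fx /= mul0mx -rowE !mxE scale1r scale0r addr0.
  - by move=> i; rewrite ab_y Fy /= mul0mx -rowE !mxE scale1r scale0r add0r.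
  - by rewrite ab_z Fz /= !mul0mx !mxE !scale0r addr0.
have abP h : ab h = 0%R <-> balanced (F h).
  rewrite abE; split=> [/rowP e|[-> ->]]; last by rewrite mxE !scale0r addr0.
  have := e ord0; have := e (inord 1); rewrite !mxE /=.
  rewrite -!val_eqE /= inordK //= !mulr1 !mulr0 !addr0 !add0r => e1 e0.
  by split; apply/rowP => i; rewrite !ord1 [in RHS]mxE ?e0 ?e1 // mxE.
have psi1 : psi gone = gone := ghom1 psi_hom.
(* On the subgroup of [T0], [f] is the lift of [psi] conjugated by [gauge], so there [psi]
   determines the element. *)
have inL : let L := gen_sub (fun c : C => exists2 j, j \in T0 & c = u j) in
   forall a, L a -> gauge ** f a = slift (psi a) ** gauge.
  move=> L a; elim: a / => [|a [j jT ->]|a b _ IHa _ IHb|a _ IH].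
  - by rewrite psi1 (ghom1 fM) gmulr1 (ghom1 slift_hom) gmul1.
  - by rewrite fu psi_u gauge_sgen.
  - by rewrite fM psi_hom slift_hom gmulA IHa -!gmulA IHb.
  - rewrite (ghomV fM) (ghomV psi_hom) (ghomV slift_hom).
    apply: (@gmulIr _ (f a)); rewrite gmulVK; apply: (@gmulI _ (slift (psi a))).
    by rewrite -gmulA IH !gmulA gmulrV gmul1.
have Linj : let L := gen_sub (fun c : C => exists2 j, j \in T0 & c = u j) in
   forall a b, L a -> L b -> psi a = psi b -> a = b.
  move=> L a b /inL ea /inL eb e; apply: finj; apply: (@gmulI _ gauge).
  by rewrite ea eb e.
have Lsurj : let L := gen_sub (fun c : C => exists2 j, j \in T0 & c = u j) in
   forall s : PermGroup, exists a, L a /\ psi a = s.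
  move=> L; pose P s := exists a, L a /\ psi a = s.
  have P1 : P gone by exists gone; split=> //; apply: gen_one.
  have PM s t : P s -> P t -> P (s ** t).
    move=> [a [La <-]] [b [Lb <-]]; exists (a ** b); split; last exact: psi_hom.
    exact: gen_mul.
  apply: tperm_gen => //; apply: T0_transitive.
  - by move=> a; rewrite tperm1.
  - by move=> a b; rewrite tpermC.
  - by move=> a b c; apply: (tperm_rel_trans P1 PM).
  - by move=> j jT; exists (u j); split=> //; apply: gen_in; exists j.
have phi_hom c d : phi (c ** d) = act (psi d) (phi c) ** phi d.
  by apply: Finj; rewrite FM Fact !Fphi sheis_conj sheisM fM smodel_mul /= fpsi.
have phi_uniq c d : psi c = psi d -> phi c = phi d -> c = d.
  move=> e1 e2; apply: finj; have := congr1 F e2; rewrite !Fphi => -[ex ey ez].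
  by apply: smod_eq => //; rewrite !fpsi.
have phi_ex s k : ab k = 0%R -> exists c, psi c = s /\ phi c = k.
  move=> /abP [bx by']; have [] := fsurj (Smod s (sx (F k)) (sy (F k)) (sz (F k))); first by split.
  move=> c ec; exists c; split; first by rewrite -fpsi ec.
  by apply: Finj; rewrite Fphi ec -FE.
have ab_phi c : ab (phi c) = 0%R.
  by apply/abP; rewrite Fphi; have [] := fb c.
have [zC fz] : exists zC, f zC = sheis 0%R 0%R 1%R by apply: fsurj; split; apply: zsum0.
have fzn n : f (gpow zC n) = sheis 0%R 0%R n by rewrite ghom_gpow // fz sheis_gpow intz.
have zpow c : (exists n, f c = sheis 0%R 0%R n) <-> exists n, c = gpow zC n.
  by split=> -[n e]; exists n; [apply: finj; rewrite e fzn | rewrite e fzn].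
have psi_surj (s : PermGroup) : exists c, psi c = s.
  by have [a [_ <-]] := Lsurj s; exists a.
split; [|split].
- split=> //; split=> // c.
  have [l [Ll pl]] := Lsurj (psi c); exists (c ** ginv l, l); split=> [|[k' l'] /= [pk' Ll' ec]].
    split=> //=; last by rewrite gmulVK.
    by rewrite /gker psi_hom (ghomV psi_hom) pl gmulrV.
  have el : l' = l by apply: Linj => //; rewrite pl ec psi_hom pk' gmul1.
  by rewrite ec -el gmulK.
- exists phi; split=> [a b pa pb|a _|a b pa pb e|h /abP hb].
  + rewrite phi_hom pb; congr (_ ** _); apply: Finj; rewrite Fact.
    by rewrite (ghom1 slift_hom) gconj1r.
  + exact: ab_phi.
  + by apply: phi_uniq => //; rewrite pa pb.
  + by have [|c [pc ec]] := phi_ex gone h; [apply/abP | exists c].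
exists phi; split=> // [s k kab|].
  have [c [pc ec]] := phi_ex s k kab; exists c; split=> // d [pd ed].
  by apply: phi_uniq; rewrite ?pc ?ec.
exists zC; split.
- by rewrite -fpsi fz.
- by apply: Finj; rewrite Fphi fz Fz.
- by move=> n /(congr1 f); rewrite fzn (ghom1 fM) => -[].
- move=> c; rewrite -zpow; split=> [cc|[n e] d]; last first.
    by apply: finj; rewrite !fM e sheis_central.
  apply: smodel_central => // s; have [d ed] := fsurj _ (balanced_slift s).
  by rewrite -ed /gcommute -!fM cc.
(* Only the central coordinate is forgotten, so on the kernel of [psi] the fibre over 0 consists of
   the powers of [zC]. *)
exists (fun c => row_mx (tl (sx (f c))) (tl (sy (f c)))); split.
- move=> a b pa pb; rewrite fM smodel_mul /= fpsi pb perm_mx1 !mulmx1 !tlD.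
  by rewrite -[LHS](add_row_mx (m := 1) (n1 := 17) (n2 := 17)).
- move=> v; have [a za ea] := tl_surj (lsubmx (v : 'rV_(17 + 17))).
  have [b zb eb] := tl_surj (rsubmx (v : 'rV_(17 + 17))).
  have [|c ec] := fsurj (sheis a b 0%R); first by split.
  exists c; first by rewrite /gker -fpsi ec.
  by rewrite ec /= ea eb hsubmxK.
move=> a pa; rewrite -zpow; split=> [e|[n ->]]; last by rewrite /= !tl0 row_mx0.
have [bx by'] := fb a; exists (sz (f a)); apply: smod_eq => //=.
- by rewrite fpsi pa.
- by apply: tl_eq0 => //; have := congr1 (@lsubmx _ 1 17 17) e; rewrite row_mxKl linear0.
- by apply: tl_eq0 => //; have := congr1 (@rsubmx _ 1 17 17) e; rewrite row_mxKr linear0.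
Qed.
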